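(* For every integer $g\ge 1$, the surgery graph $K_g$ is connected.
   Context: $\Sigma_g$ denotes a closed oriented surface of genus $g\ge 1$. A collection $\Gamma$ of closed curves on $\Sigma_g$ in generic position (only transverse double points) is regarded as a 4-valent graph embedded in $\Sigma_g$: vertices are the intersection points, edges are the arcs between them. It is one-faced if $\Sigma_g\setminus\Gamma$ is a single open disk. Cutting $\Sigma_g$ along a one-faced $\Gamma$ gives a polygon $P_\Gamma$ with $8g-4$ sides; each edge of $\Gamma$ gives two sides, and the sides of $P_\Gamma$ are called the oriented edges of $\Gamma$ ($x$ and $\bar x$ denote the two sides of the same edge). Surgery: let $x,y$ be two oriented edges of a one-faced collection $\Gamma$ belonging to distinct edges of $\Gamma$. Let $\lambda_{x,y}$ be the simple arc, unique up to homotopy, whose interior is disjoint from $\Gamma$ (it lies in the interior of $P_\Gamma$) and which joins an interior point of the side $x$ to an interior point of the side $y$. The collection $\sigma_{x,y}(\Gamma)$ is obtained by cutting open $\Gamma$ along $\lambda_{x,y}$: remove from each of the two edges a small open subarc around the endpoint of $\lambda_{x,y}$, and join the four resulting ends by two disjoint parallel copies of $\lambda_{x,y}$, one on each side of $\lambda_{x,y}$. When $\sigma_{x,y}(\Gamma)$ is one-faced, the operation $\Gamma\to\sigma_{x,y}(\Gamma)$ is called a surgery. The surgery graph $K_g$ has as vertices the homeomorphism classes of one-faced collections on $\Sigma_g$ (two collections are identified if a homeomorphism of $\Sigma_g$ maps one to the other); two distinct vertices are joined by an edge if they have representatives connected by a surgery. *)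

(* Defs.v *)
From mathcomp Require Import all_boot all_fingroup.
From Stdlib Require Import Relation_Operators.
Set Implicit Arguments.
Unset Strict Implicit.
Unset Printing Implicit Defensive.

(** A collection of closed curves in generic position on a closed oriented
    surface, all of whose complementary regions are open disks, is represented
    by its rotation system.  A dart [d] is a half-edge of the 4-valent graph
    [G]; it is identified with the oriented edge leaving along [d], seen as the
    side of a complementary polygon which has that polygon on its left.
    - [node d] is the next half-edge counterclockwise around the vertex of [d];
      vertices are the orbits of [node].
    - [bar d] is the other half of the edge of [d], hence also the other side
      of this edge; edges are the orbits of [bar].
    The curves themselves are recovered by going straight at each vertex, i.e.
    they are the orbits of [fun d => node (node (bar d))], up to orientation. *)
Record collection : Type := Collection {
  dart :> finType;
  node : {perm dart};
  bar : {perm dart};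
  node_4valent : forall d, #|porbit node d| = 4;
  barK : involutive bar;
  bar_neq : forall d, bar d != d
}.

(** The boundary of a complementary region, traversed with the region on the
    left: after the side [d] comes [node^-1 (bar d)]. *)
Definition face (G : collection) : {perm dart G} :=
  (bar G * (node G)^-1)%g.

Definition one_faced (G : collection) : Prop := #|porbits (face G)| = 1.

(** Euler's formula V - E + F = 2 - 2g.  It characterizes the genus only for a
    connected surface; this is automatic for one-faced collections, since
    [face] then acts transitively on the darts. *)
Definition has_genus (g : nat) (G : collection) : Prop :=
  #|porbits (node G)| + #|porbits (face G)| + 2 * g = #|porbits (bar G)| + 2.

Definition one_faced_on (g : nat) (G : collection) : Prop :=
  one_faced G /\ has_genus g G.

(** Homeomorphisms of the surface may reverse its orientation, in which case
    they reverse the cyclic order around the vertices. *)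
Definition homeomorphic (G H : collection) : Prop :=
  exists h : dart G -> dart H,
    [/\ bijective h,
        forall d, h (bar G d) = bar H (h d)
      & (forall d, h (node G d) = node H (h d)) \/
        (forall d, h (node G d) = (node H)^-1%g (h d))].

Definition distinct_edges (G : collection) (x y : dart G) : Prop :=
  y != x /\ y != bar G x.

Lemma barJK (G : collection) (x y : dart G) :
  involutive (bar G ^ tperm x y)%g.
Proof.
by move=> d; rewrite -{1}(tpermK x y d) permJ permJ barK tpermK.
Qed.

Lemma barJ_neq (G : collection) (x y : dart G) d :
  (bar G ^ tperm x y)%g d != d.
Proof.
by rewrite -{1 2}(tpermK x y d) permJ (inj_eq perm_inj) bar_neq.
Qed.

(** [cut_open x y] is the collection sigma_{x,y}(G) for [x], [y] on distinct
    edges.  Cutting along the arc lambda_{x,y} inside the polygon leaves the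
    vertices and half-edges unchanged.  The oriented edge [x] consists of the
    half-edge [x] followed by [bar x], and likewise for [y]; since [x] and [y]
    both have the polygon on their left, one parallel copy of lambda_{x,y}
    joins the end of [x] to the beginning of [y] and the other the end of [y]
    to the beginning of [x].  Hence the new edges are {bar x, y} and {bar y, x}
    (see [cut_openE]). *)
Definition cut_open (G : collection) (x y : dart G) : collection :=
  @Collection (dart G) (node G) (bar G ^ tperm x y)%g
    (@node_4valent G) (barJK x y) (@barJ_neq G x y).

Lemma cut_openE (G : collection) (x y d : dart G) :
  distinct_edges x y ->
  bar (cut_open x y) d =
    if d == x then bar G y else if d == bar G y then x
    else if d == y then bar G x else if d == bar G x then y
    else bar G d.
Proof.
case=> yx ybx; have xby : x != bar G y.
  by apply: contra ybx => /eqP->; rewrite barK.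
have [nx ny] := (bar_neq x, bar_neq y).
rewrite /= -{1}(tpermK x y d) permJ.
case: (tpermP x y d) => [->|->|/eqP dx /eqP dy].
- by rewrite eqxx tpermD // eq_sym.
- by rewrite (negPf yx) eqxx eq_sym (negPf ny) tpermD // eq_sym.
rewrite (negPf dx) (negPf dy).
case: eqP => [->|/eqP dby]; first by rewrite barK tpermR.
case: eqP => [->|/eqP dbx]; first by rewrite barK tpermL.
by rewrite tpermD // eq_sym; [apply: contra dbx | apply: contra dby];
   move=> /eqP <-; rewrite barK.
Qed.

(** Vertices of K_g: homeomorphism classes of one-faced collections on the
    closed oriented surface of genus [g]. *)
Definition is_class (g : nat) (C : collection -> Prop) : Prop :=
  exists2 G, one_faced_on g G & C = homeomorphic G.

Definition Kvertex (g : nat) : Type := {C : collection -> Prop | is_class g C}.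

Definition surgery_step (g : nat) (u v : Kvertex g) : Prop :=
  exists (G : collection) (x y : dart G),
    [/\ sval u G, distinct_edges x y, one_faced (cut_open x y)
      & sval v (cut_open x y)].

Definition Kedge (g : nat) (u v : Kvertex g) : Prop :=
  u <> v /\ (surgery_step u v \/ surgery_step v u).

Definition connected_graph (V : Type) (e : V -> V -> Prop) : Prop :=
  inhabited V /\ forall u v : V, clos_refl_trans V e u v.

(* Main.v *)
Require Import Defs.
From mathcomp Require Import all_boot.
From mathcomp Require Import all_fingroup zify.
From Stdlib Require Import Relation_Operators Classical FunctionalExtensionality.
From Stdlib Require Import PropExtensionality ProofIrrelevance.
(** Every surgery on the chords {x, x'} and {y, y'} of the polygon (where
    x' = bar x) that keeps it connected rewrites the cyclic word of its sides:
      x A x' B y C y' D  becomes  x C y' B y A x' D.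
    The theorem follows by induction on the genus.  A handle can be inserted on
    any edge of a one-faced collection; surgeries lift to the collection with
    the handle, and surgeries move the handle to any other edge.  Conversely,
    some vertex v0 v1 v2 v3 of a one-faced collection is met by the face in the
    order v0, v1, v2, v3 (count the ascents of the position along the face);
    at most two surgeries then create a closed curve with one vertex, the two
    remaining half-edges of which are the ends of a curve that at most two more
    surgeries close up after crossing a single strand: this is a handle. *)

Set Implicit Arguments.
Unset Strict Implicit.
Unset Printing Implicit Defensive.

(** Cutting open re-pairs half-edges and never touches [node], so the number of half-edges is
    constant; for a one-faced collection of genus g it is 8g - 4. A handle therefore has to bring
    exactly eight half-edges, that is, two vertices. The obstacle is that cutting along two crossing
    chords never leaves a single face, whichever of their sides are chosen, so every construction
    has to exhibit uncrossed chords. This explains the role of short chords: inside a handle u3, v0,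
    v1 are consecutive sides and u3 is paired with v1; at a closed curve with one vertex, bar v3,
    v2, v3 are consecutive. In both cases the chord joining the outer two sides crosses only the
    chord of the middle one, so it can be combined with almost any other chord. All moves are made
    up to isomorphisms that preserve [node], hence the orientation; orientation-reversing
    homeomorphisms matter only when passing to classes. *)

Ltac count_perm :=
  apply/seq.permP=> ?; rewrite /= ?map_cat /=; repeat rewrite count_cat /=;
  repeat match goal with |- context [nat_of_bool ?b] => move: (nat_of_bool b) => ? end;
  clear; lia.

Lemma porbit_step (T : finType) (s : {perm T}) x y :
  y \in porbit s x -> s y \in porbit s x.
Proof. by case/porbitP=> i ->; apply/porbitP; exists i.+1; rewrite expgSr permM. Qed.

(** * Faces as orbits and as cyclic lists of sides *)

Section Basics.
Variable G : collection.
Implicit Types d e x y : G.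

Lemma node4 d : node G (node G (node G (node G d))) = d.
Proof. by have := iter_porbit (node G) d; rewrite node_4valent. Qed.

Lemma node_uniq d :
  uniq [:: d; node G d; node G (node G d); node G (node G (node G d))].
Proof. by have := uniq_traject_porbit (node G) d; rewrite node_4valent. Qed.

Lemma node_inj d e : node G d = node G e -> d = e.
Proof. exact: perm_inj. Qed.

Lemma bar_inj d e : bar G d = bar G e -> d = e.
Proof. exact: perm_inj. Qed.

Lemma node_face d : node G (face G d) = bar G d.
Proof. by rewrite /face permM permKV. Qed.

Lemma face_eq d e : bar G d = node G e -> face G d = e.
Proof. by rewrite -node_face => /node_inj. Qed.

(** A single face is used as an induction principle along [face]; with the converse [one_facedI], it
    spares later proofs any handling of orbits. *)
Lemma one_faced_ind d0 (P : pred G) :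
  one_faced G -> (forall d, P d -> P (face G d)) -> P d0 -> forall d, P d.
Proof.
move=> /eqP/cards1P[X defX] closedP Pd0 d.
have orbX e : porbit (face G) e = X.
  by apply/set1P; rewrite -defX; apply: imset_f.
have : d \in porbit (face G) d0 by rewrite orbX -(orbX d) porbit_id.
by case/porbitP=> i ->; rewrite permX; elim: i => //= i /closedP.
Qed.

Lemma one_facedI d0 :
  (forall P : pred G, (forall d, P d -> P (face G d)) -> P d0 -> forall d, P d) ->
  one_faced G.
Proof.
move=> ind; apply/eqP/cards1P; exists (porbit (face G) d0).
apply/setP=> X; rewrite inE; apply/imsetP/eqP => [[e _ ->]|->]; last by exists d0.
apply/eqP; rewrite eq_porbit_mem.
apply: (ind (fun e => e \in porbit (face G) d0)); last exact: porbit_id.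
by move=> d /porbit_step.
Qed.

Lemma one_faced_inhabited : one_faced G -> exists d : G, true.
Proof.
move=> /eqP/cards1P[X defX].
have /imsetP[d _ _] : X \in porbits (face G) by rewrite defX set11.
by exists d.
Qed.

(** Equivalent to [face G d = e], but without the inverse of [node], so that steps can be checked by
    evaluating [bar] and [node]. *)
Definition face_step : rel G := [rel d e | bar G d == node G e].

Definition face_list (s : seq G) : Prop :=
  [/\ uniq s, path.cycle face_step s & forall d, d \in s].

Lemma face_list_exists d : one_faced G -> exists s, face_list (d :: s).
Proof.
move=> G1; pose t := traject (face G) (face G d) #|porbit (face G) d|.-1.
have orb0 : 0 < #|porbit (face G) d| by rewrite (cardD1 d) porbit_id.
have defp : traject (face G) d #|porbit (face G) d| = d :: t.
  by rewrite -{1}(prednK orb0) trajectS.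
exists t; split.
- by rewrite -defp uniq_traject_porbit.
- have stepE : face_step =2 frel (face G).
    move=> x y; change ((bar G x == node G y) = (face G x == y)).
    by rewrite -node_face (inj_eq perm_inj).
  rewrite (eq_cycle stepE) /= rcons_path fpath_traject /=.
  rewrite last_traject -iterS prednK //; apply/eqP.
  by rewrite iter_porbit.
move=> e; rewrite -defp -porbit_traject.
apply: (one_faced_ind (P := fun e => e \in porbit (face G) d) G1) (porbit_id _ _) e.
by move=> x /porbit_step.
Qed.

Lemma face_list_one_faced d s : face_list (d :: s) -> one_faced G.
Proof.
case=> _ cyc all_s; apply: (@one_facedI d) => P closedP Pd e.
move: (all_s e) cyc; rewrite inE => /predU1P[-> //|].
case/splitPr => s1 s2; rewrite /= rcons_cat cat_path /= => /and3P[+ + _].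
elim: s1 d Pd {all_s} => [|x s1 IHs] d Pd /=.
  by move=> _ /eqP/face_eq<-; rewrite closedP.
move=> /andP[/eqP/face_eq dx p] q; apply: (IHs x) => //.
by rewrite -dx closedP.
Qed.

Lemma face_list_rot s1 s2 : face_list (s1 ++ s2) -> face_list (s2 ++ s1).
Proof.
case=> U C all_s; split; first by rewrite uniq_catC.
  by rewrite -(rot_cycle (size s1)) rot_size_cat in C.
by move=> d; rewrite mem_cat orbC -mem_cat.
Qed.

Lemma face_list_bar s1 d e s2 :
  face_list (s1 ++ d :: e :: s2) -> bar G d = node G e.
Proof.
move/face_list_rot => [_ /= /andP[/eqP-> _] _] //.
Qed.

Lemma face_list_bar_last d s : face_list (d :: s) -> bar G (last d s) = node G d.
Proof.
by case=> _; rewrite /= rcons_path => /andP[_ /eqP].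
Qed.

End Basics.

(** * Effect of cutting open on the cyclic word of sides *)

(** The starting side may change from [x] to [y]: when sides are re-paired, each untouched piece [W]
    of the word keeps its inner steps and only receives a new predecessor. *)
Lemma path_rel_map (T U : eqType) (J : T -> U) (b f : T -> T) (b' f' : U -> U) x y W z :
  path [rel d e | b d == f e] x (rcons W z) -> b' y = J (b x) ->
  {in W, forall d, b' (J d) = J (b d)} -> (forall d, f' (J d) = J (f d)) ->
  path [rel d e | b' d == f' e] y (rcons (map J W) (J z)).
Proof.
move=> + + + fJ; elim: W x y => [|w W IHW] x y /=.
  by rewrite !andbT fJ => /eqP-> -> _.
move=> /andP[/eqP xw Wp] yx bW; rewrite yx fJ xw eqxx /=.
apply: (IHW w) Wp _ _; first by rewrite bW ?mem_head.
by move=> d Wd; rewrite bW // inE Wd orbT.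
Qed.

Lemma path_rel_eq (T : eqType) (b b' f : T -> T) x y W z :
  path [rel d e | b d == f e] x (rcons W z) -> b' y = b x ->
  {in W, b' =1 b} -> path [rel d e | b' d == f e] y (rcons W z).
Proof. by move=> p yx bW; rewrite -(map_id W); apply: path_rel_map p _ _ _. Qed.

Section CutOpen.
Variables (G : collection) (x y : G).
Hypothesis xy : distinct_edges x y.

Lemma cut_bar1 : bar (cut_open x y) x = bar G y.
Proof. by rewrite cut_openE // eqxx. Qed.

Lemma cut_bar2 : bar (cut_open x y) (bar G y) = x.
Proof. by rewrite -[in LHS]cut_bar1 barK. Qed.

Lemma cut_bar3 : bar (cut_open x y) y = bar G x.
Proof.
case: (xy) => /negPf yx /negPf ybx; rewrite cut_openE // yx eqxx.
by rewrite eq_sym (negPf (bar_neq y)).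
Qed.

Lemma cut_bar4 : bar (cut_open x y) (bar G x) = y.
Proof. by rewrite -[in LHS]cut_bar3 barK. Qed.

Lemma cut_bar_out d :
  d \notin [:: x; bar G x; y; bar G y] -> bar (cut_open x y) d = bar G d.
Proof.
rewrite !inE !negb_or => /and4P[/negPf dx /negPf dbx /negPf dy /negPf dby].
by rewrite cut_openE // dx dbx dy dby.
Qed.

Lemma cut_face_list A B C D :
  face_list (x :: A ++ bar G x :: B ++ y :: C ++ bar G y :: D) ->
  face_list (G := cut_open x y) (x :: C ++ bar G y :: B ++ y :: A ++ bar G x :: D).
Proof.
case=> U cyc all_s.
rewrite /= !(rcons_cat, rcons_cons, =^~ cat_rcons) !cat_path !last_rcons in cyc.
case/and4P: cyc => pA pB pC pD.
have perm_s : perm_eq (x :: A ++ bar G x :: B ++ y :: C ++ bar G y :: D)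
    (x :: C ++ bar G y :: B ++ y :: A ++ bar G x :: D).
  by count_perm.
have perm_4 : perm_eq (x :: A ++ bar G x :: B ++ y :: C ++ bar G y :: D)
    ([:: x; bar G x; y; bar G y] ++ (A ++ B ++ C ++ D)).
  by count_perm.
have out d : d \in A ++ B ++ C ++ D -> bar (cut_open x y) d = bar G d.
  move=> Wd; apply: cut_bar_out.
  by move: U; rewrite (perm_uniq perm_4) cat_uniq => /and3P[_ /hasPn dis _]; apply: dis.
have U' := U; rewrite (perm_uniq perm_s) in U'.
split; first exact: U'.
  rewrite /= !(rcons_cat, rcons_cons, =^~ cat_rcons) !cat_path !last_rcons.
  apply/and4P; split; [move: pC|move: pB|move: pA|move: pD] => /path_rel_eq; apply;
    rewrite ?(cut_bar1, cut_bar2, cut_bar3, cut_bar4) ?barK // => d Wd;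
    by apply: out; rewrite !mem_cat Wd ?orbT.
by move=> d; have := all_s d; rewrite (perm_mem perm_s).
Qed.

End CutOpen.

(** * Equivalence under surgeries, and the genus as a number of half-edges *)

Definition iso (G H : collection) : Prop :=
  exists h : G -> H,
    [/\ bijective h, forall d, h (bar G d) = bar H (h d)
      & forall d, h (node G d) = node H (h d)].

Lemma iso_refl G : iso G G.
Proof. by exists id; split=> //; exists id. Qed.

Lemma iso_sym G H : iso G H -> iso H G.
Proof.
case=> h [[k hK kK] hb hn]; exists k; split; first by exists h.
- by move=> d; apply: (can_inj hK); rewrite hb !kK.
- by move=> d; apply: (can_inj hK); rewrite hn !kK.
Qed.

Lemma iso_card G H : iso G H -> #|G| = #|H|.
Proof. by case=> h [bij_h _ _]; apply: bij_eq_card bij_h. Qed.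

Lemma iso_one_faced G H : iso G H -> one_faced G -> one_faced H.
Proof.
case=> h [[k hK kK] hb hn] G1; have [d0 _] := one_faced_inhabited G1.
apply: (@one_facedI _ (h d0)) => P closedP Pd d; rewrite -(kK d).
apply: (@one_faced_ind _ d0 (fun e => P (h e)) G1) => // e /closedP.
suff -> : face H (h e) = h (face G e) by [].
by apply: face_eq; rewrite -hn node_face hb.
Qed.

(** Symmetry is built in, so that no surgery has to be undone explicitly. The genus is absent
    because it is recovered from the number of half-edges, which is invariant. *)
Inductive conn : collection -> collection -> Prop :=
| conn_iso (G H : collection) : iso G H -> conn G H
| conn_cut (G : collection) (x y : G) : one_faced G -> distinct_edges x y ->
    one_faced (cut_open x y) -> conn G (cut_open x y)
| conn_sym (G H : collection) : conn G H -> conn H G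
| conn_trans (G H K : collection) : conn G H -> conn H K -> conn G K.

Lemma conn_refl G : conn G G.
Proof. exact: conn_iso (iso_refl G). Qed.

Lemma conn_one_faced G H : conn G H -> one_faced G <-> one_faced H.
Proof.
elim=> {G H} [G H GH|G x y G1 _ ? //|G H _ -> //|G H K _ -> _ -> //].
by split; apply: iso_one_faced => //; apply: iso_sym.
Qed.

Lemma conn_card G H : conn G H -> #|G| = #|H|.
Proof. by elim=> {G H} // [G H /iso_card //|G H K _ -> _ ->]. Qed.

Lemma card_porbits_const (T : finType) (s : {perm T}) k :
  (forall x, #|porbit s x| = k) -> #|porbits s| * k = #|T|.
Proof.
move=> sk; have part : partition (porbits s) [set: T].
  apply/and3P; split.
  - apply/eqP/setP=> x; rewrite inE; apply/bigcupP.
    by exists (porbit s x); [apply: imset_f|apply: porbit_id].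
  - apply/trivIsetP=> _ _ /imsetP[x _ ->] /imsetP[y _ ->] xy.
    rewrite -setI_eq0; apply: contraNT xy => /set0Pn[z /setIP[zx zy]].
    by move: zx zy; rewrite -!eq_porbit_mem => /eqP<- /eqP<-.
  apply/imsetP=> [[x _ s0]]; have := porbit_id s x.
  by rewrite -s0 inE.
rewrite -cardsT (@card_uniform_partition _ k _ _ _ part) // => _ /imsetP[x _ ->].
exact: sk.
Qed.

Lemma card_porbit4 (T : finType) (s : {perm T}) x :
  s (s (s (s x))) = x -> uniq [:: x; s x; s (s x); s (s (s x))] ->
  #|porbit s x| = 4.
Proof.
move=> s4 U; rewrite -[RHS]/(size [:: x; s x; s (s x); s (s (s x))]).
rewrite -(card_uniqP U); apply: eq_card => y; apply/porbitP/idP.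
  case=> i ->; rewrite permX; elim: i => [|i] /=; first by rewrite mem_head.
  rewrite !inE => /or4P[] /eqP->; rewrite ?s4 eqxx ?orbT //.
rewrite !inE => /or4P[] /eqP->; [exists 0|exists 1|exists 2|exists 3];
  by rewrite permX.
Qed.

(** Orbits of [node] have four elements and orbits of [bar] two, so V and E are a quarter and a half
    of [#|G|], while F = 1. *)
Lemma has_genusE g G : one_faced G -> has_genus g G <-> #|G| + 4 = 8 * g.
Proof.
move=> G1; rewrite /has_genus G1.
have := card_porbits_const (@node_4valent G).
have : #|porbits (bar G)| * 2 = #|G|.
  apply: card_porbits_const => d.
  have -> : porbit (bar G) d = [set d; bar G d].
    apply/setP=> e; rewrite !inE; apply/porbitP/orP.
      case=> i ->; rewrite permX; elim: i => [|i] /=; first by left.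
      by case=> /eqP->; [right|left; rewrite barK].
    by case=> /eqP->; [exists 0; rewrite expg0 perm1|exists 1; rewrite expg1].
  by rewrite cards2 eq_sym bar_neq.
by lia.
Qed.

Lemma conn_one_faced_on g G H : conn G H -> one_faced_on g G <-> one_faced_on g H.
Proof.
move=> GH; have [GH1 GH2] := conn_one_faced GH; have cGH := conn_card GH.
split=> -[F1 gF]; [have F2 := GH1 F1 | have F2 := GH2 F1]; split=> //.
  by apply/(has_genusE _ F2); rewrite -cGH; apply/has_genusE.
by apply/(has_genusE _ F2); rewrite cGH; apply/has_genusE.
Qed.

(** * Inserting a handle *)

(* The four positions around a vertex are coded 00, 01, 11, 10, so that the
   quarter turn and the half turn have uniform descriptions. *)
Definition rot4 (p : bool * bool) : bool * bool := (p.2, ~~ p.1).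
Definition gadget : finType := (bool * (bool * bool))%type.

Definition gu (p : bool * bool) : gadget := (false, p).
Definition gv (p : bool * bool) : gadget := (true, p).

Notation p0 := (false, false).
Notation p1 := (false, true).
Notation p2 := (true, true).
Notation p3 := (true, false).

(* Two vertices u and v are added: the edge of [a] is replaced by the strand
   a - u0, u2 - bar a, crossed at u by the closed curve with edges u1 - v3 and
   u3 - v1, itself crossed at v by the closed curve with edge v0 - v2. *)
Section Insert.
Variables (G : collection) (a : G).

Definition ins_node_fun (d : G + gadget) : G + gadget :=
  match d with
  | inl d => inl (node G d)
  | inr (s, p) => inr (s, rot4 p)
  end.

(** In the last branch, complementing both bits is the half turn, and [i (+) j] is true exactly at
    positions 1 and 3, whose edges run between u and v. *)
Definition ins_bar_fun (d : G + gadget) : G + gadget :=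
  match d with
  | inl d => if d == a then inr (gu p0) else
             if d == bar G a then inr (gu p2) else inl (bar G d)
  | inr (false, (false, false)) => inl a
  | inr (false, (true, true)) => inl (bar G a)
  | inr (s, (i, j)) => inr (s (+) (i (+) j), (~~ i, ~~ j))
  end.

Lemma ins_node_inj : injective ins_node_fun.
Proof.
move=> [d|[[] [[] []]]] [e|[[] [[] []]]] //= [].
by move/perm_inj->.
Qed.

Lemma ins_barK : involutive ins_bar_fun.
Proof.
have ba : (bar G a == a) = false by apply/negbTE/bar_neq.
move=> [d|[[] [[] []]]] //=; rewrite ?eqxx ?ba ?eqxx //.
case: eqP => [->|/eqP da] //=; case: eqP => [->|/eqP dba] //=.
rewrite barK; case: eqP => [bda|_]; first by rewrite -bda barK eqxx in dba.
by rewrite (inj_eq perm_inj) (negPf da).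
Qed.

Definition ins_node := perm ins_node_inj.
Definition ins_bar := perm (inv_inj ins_barK).

Lemma ins_4valent d : #|porbit ins_node d| = 4.
Proof.
apply: card_porbit4; rewrite !permE; case: d => [d|[[] [[] []]]] //=.
  by rewrite node4.
by have := node_uniq d; rewrite -(map_inj_uniq (@inl_inj _ gadget)).
Qed.

Lemma ins_barK' : involutive ins_bar.
Proof. by move=> d; rewrite !permE ins_barK. Qed.

Lemma ins_bar_neq d : ins_bar d != d.
Proof.
rewrite permE; case: d => [d|[[] [[] []]]] //=.
by do 2?case: ifP => // _; rewrite (inj_eq (@inl_inj _ _)) bar_neq.
Qed.

Definition insert : collection :=
  Collection ins_4valent ins_barK' ins_bar_neq.

End Insert.

Definition lift_inl (T U : Type) (h : T -> U) (d : T + gadget) : U + gadget :=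
  match d with inl d => inl (h d) | inr p => inr p end.

Lemma lift_inl_bij (T U : Type) (h : T -> U) : bijective h -> bijective (lift_inl h).
Proof.
by case=> k hK kK; exists (lift_inl k) => -[d|p] //=; rewrite ?hK ?kK.
Qed.

Lemma insert_bar_lift (G H : collection) (h : G -> H) (a : G) :
  injective h -> (forall d, h (bar G d) = bar H (h d)) ->
  forall d, lift_inl h (ins_bar a d) = ins_bar (h a) (lift_inl h d).
Proof.
move=> h_inj hb d; rewrite !permE; case: d => [d|[[] [[] []]]] //=; rewrite -?hb //.
by rewrite !(inj_eq h_inj); case: eqP => // _; case: eqP.
Qed.

Lemma insert_iso (G H : collection) (h : G -> H) (a : G) :
  bijective h -> (forall d, h (bar G d) = bar H (h d)) ->
  (forall d, h (node G d) = node H (h d)) -> iso (insert a) (insert (h a)).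
Proof.
move=> h_bij hb hn; exists (lift_inl h); split; first exact: lift_inl_bij.
  exact/insert_bar_lift/hb/bij_inj.
by move=> d; rewrite /= !permE; case: d => [d|[]] //=; rewrite hn.
Qed.

(* Half-turn of both added vertices. *)
Lemma insert_iso_bar (G : collection) (a : G) : iso (insert a) (insert (bar G a)).
Proof.
pose f (d : G + gadget) : G + gadget :=
  match d with inl d => inl d | inr (s, (i, j)) => inr (s, (~~ i, ~~ j)) end.
have fK : involutive f by case=> [d|[s [[] []]]].
exists f; split; first by exists f.
  move=> d; rewrite !permE; case: d => [d|[[] [[] []]]] //=; rewrite ?barK //.
  case: (d =P a) => [->|_]; first by rewrite eq_sym (negPf (bar_neq a)).
  by case: eqP.
by move=> d; rewrite !permE; case: d => [d|[[] [[] []]]].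
Qed.

Lemma tperm_inl (T : finType) (x y : T) (d : T + gadget) :
  tperm (inl x) (inl y) d = lift_inl (tperm x y) d.
Proof.
case: d => [d|p] /=; last by rewrite tpermD.
have [->|dx] := eqVneq d x; first by rewrite !tpermL.
have [->|dy] := eqVneq d y; first by rewrite !tpermR.
by rewrite !tpermD // eq_sym.
Qed.

Section InsertOneFaced.
Variables (G : collection) (a : G).
Implicit Types s A B : seq G.

Let J : G -> insert a := inl.
Let U p : insert a := inr (gu p).
Let V p : insert a := inr (gv p).

Lemma insert_face_list A B :
  face_list (a :: A ++ bar G a :: B) ->
  face_list (G := insert a)
    (J a :: U p3 :: V p0 :: V p1 :: U p2 :: map J A ++
     J (bar G a) :: U p1 :: V p2 :: V p3 :: U p0 :: map J B).
Proof.
case=> uniq_s cyc all_s.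
have perm_s : perm_eq (a :: A ++ bar G a :: B) ([:: a; bar G a] ++ (A ++ B)).
  by count_perm.
have out d : d \in A ++ B -> ins_bar a (J d) = J (bar G d).
  move=> Wd; have : d \notin [:: a; bar G a].
    by move: uniq_s; rewrite (perm_uniq perm_s) cat_uniq => /and3P[_ /hasPn dis _]; apply: dis.
  by rewrite !inE negb_or permE /= => /andP[/negPf-> /negPf->].
set t := (X in face_list X).
have perm_t : perm_eq t (map J (a :: A ++ bar G a :: B) ++
    [:: U p0; U p1; U p2; U p3; V p0; V p1; V p2; V p3]).
  by rewrite /t; count_perm.
have all_t d : d \in t.
  rewrite (perm_mem perm_t) mem_cat; apply/orP.
  case: d => [d|[[] [[] []]]]; [left | by right ..].
  by rewrite (mem_map (@inl_inj _ _)) all_s.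
split=> //.
  rewrite (perm_uniq perm_t) cat_uniq (map_inj_uniq (@inl_inj _ _)) uniq_s /= andbT.
  by rewrite !negb_or; do ![apply/andP; split=> //]; apply/mapP=> -[].
rewrite /= !(rcons_cat, rcons_cons, =^~ cat_rcons) !cat_path !last_rcons in cyc.
case/andP: cyc => pA pB.
rewrite /t -cat_rcons /= !(rcons_cat, rcons_cons) /= cat_path /= last_rcons.
have aba : (bar G a == a) = false by apply/negbTE/bar_neq.
rewrite /face_step /= !permE /= !eqxx /= aba /=.
apply/andP; split.
  apply: path_rel_map pA _ _ _ => [|d Ad|d]; [by rewrite permE| |by rewrite permE].
  by rewrite out // mem_cat Ad.
apply: path_rel_map pB _ _ _ => [|d Bd|d]; [by rewrite permE barK| |by rewrite permE].
by rewrite out // mem_cat Bd orbT.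
Qed.

(** The eight new sides form two detours of the boundary, u3 v0 v1 u2 right after [a] and u1 v2 v3
    u0 right after [bar G a], so they neither merge nor split faces. *)
Lemma insert_one_faced : one_faced G <-> one_faced (insert a).
Proof.
split=> G1.
  apply: (@one_facedI (insert a) (J a)) => P closedP Pa.
  have Pg d e : bar (insert a) d = node (insert a) e -> P d -> P e.
    by move=> /face_eq <- /closedP.
  have aba : (bar G a == a) = false by apply/negbTE/bar_neq.
  have PA : P (J a) -> [/\ P (U p3), P (V p0), P (V p1), P (U p2) &
      forall e, bar G a = node G e -> P (J e)].
    have st d e : bar (insert a) d = node (insert a) e -> P d -> P e by exact: Pg.
    move=> P0; have P3 : P (U p3) by apply: st P0; rewrite !permE /= eqxx.
    have Q0 : P (V p0) by apply: st P3; rewrite !permE.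
    have Q1 : P (V p1) by apply: st Q0; rewrite !permE.
    have P2 : P (U p2) by apply: st Q1; rewrite !permE.
    by split=> // e ae; apply: st P2; rewrite !permE /= ae.
  have PB : P (J (bar G a)) -> [/\ P (U p1), P (V p2), P (V p3), P (U p0) &
      forall e, a = node G e -> P (J e)].
    move=> P0; have P1 : P (U p1) by apply: Pg P0; rewrite !permE /= aba eqxx.
    have Q2 : P (V p2) by apply: Pg P1; rewrite !permE.
    have Q3 : P (V p3) by apply: Pg Q2; rewrite !permE.
    have P0' : P (U p0) by apply: Pg Q3; rewrite !permE.
    by split=> // e ae; apply: Pg P0'; rewrite !permE /= ae.
  have PJ : forall d, P (J d).
    apply: (@one_faced_ind G a (fun d => P (J d)) G1) => // d Pd.
    case: (d =P a) Pd => [->|/eqP/negPf da] Pd.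
      by have [_ _ _ _] := PA Pd; apply; rewrite node_face.
    case: (d =P bar G a) Pd => [->|/eqP/negPf dba] Pd.
      by have [_ _ _ _] := PB Pd; apply; rewrite node_face barK.
    apply: Pg Pd; rewrite !permE /= da dba; congr inl.
    by rewrite permKV.
  have [A3 A0 A1 A2 _] := PA (PJ a).
  have [B1 B2 B3 B0 _] := PB (PJ (bar G a)).
  by case=> [d|[[] [[] []]]]; [apply: PJ|..].
apply: (@one_facedI G a) => P closedP Pa d.
(* Each new side receives the truth value of the old side, [a] or [bar G a], whose detour contains
   it. *)
pose Q (d : insert a) := match d with
  | inl d => P d
  | inr (s, (i, j)) => if (if s then ~~ i else i) then P a else P (bar G a) end.
apply: (@one_faced_ind _ (J a) Q G1) (J d) => // {d}.
have Pg d e : bar G d = node G e -> P d -> P e by move=> /face_eq <- /closedP.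
move=> d; have := node_face d; move: (face _ d) => e.
rewrite !permE; case: d => [d|[[] [[] []]]]; case: e => [e|[[] [[] []]]] //=;
  do 2?[case: eqP => [->|_] //]; move=> [] // de;
  by apply: Pg; rewrite ?barK.
Qed.

End InsertOneFaced.

(* [ins_bar] is natural in [a] and [bar], and [cut_open] conjugates [bar]. *)
Lemma insert_cut (G : collection) (a x y : G) :
  one_faced G -> distinct_edges x y -> one_faced (cut_open x y) ->
  conn (insert a) (@insert (cut_open x y) (tperm x y a)).
Proof.
move=> G1 xy K1; have [yx ybx] := xy.
have b_t d : tperm x y (bar G d) = bar (cut_open x y) (tperm x y d).
  by rewrite /= permJ.
pose K := cut_open (G := insert a) (inl x) (inl y).
have KE : iso K (@insert (cut_open x y) (tperm x y a)).
  exists id; split; [by exists id | | by move=> d; rewrite /= !permE].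
  move=> d; have := @insert_bar_lift G (cut_open x y) _ a (@perm_inj _ (tperm x y)) b_t.
  move=> /(_ (lift_inl (tperm x y) d)).
  have -> : lift_inl (tperm x y) (lift_inl (tperm x y) d) = d.
    by case: d => // d /=; rewrite tpermK.
  by move=> <-; rewrite -!tperm_inl -permJ tpermK.
apply: conn_trans (conn_iso KE); apply: conn_cut.
- exact: (insert_one_faced a).1 G1.
- split; first by rewrite (inj_eq (@inl_inj _ _)).
  by rewrite permE /=; do 2?case: ifP => // _; rewrite (inj_eq (@inl_inj _ _)).
exact: iso_one_faced (iso_sym KE) ((@insert_one_faced (cut_open x y) _).1 K1).
Qed.

(** * Moving a handle from one edge to another *)

Ltac norm_cat := rewrite /=; repeat first [rewrite -catA /= | rewrite cat_rcons /=].

Lemma face_list_rotE (G : collection) (s1 s2 s t : seq G) :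
  face_list s -> s = s1 ++ s2 -> t = s2 ++ s1 -> face_list t.
Proof. by move=> s_list s12 ->; apply: face_list_rot; rewrite -s12. Qed.

Ltac rotate_list s1 sl :=
  lazymatch type of sl with @face_list ?K _ => eapply (@face_list_rotE K s1 _ _ _ sl) end;
  [norm_cat; reflexivity|norm_cat; reflexivity].

(** The opposite sides are variables [x'] and [y'] rather than values of [bar], so that the rule can
    be iterated while [bar] changes; distinctness of the edges follows from the word having no
    repetition. *)
Lemma surgery (G : collection) (x x' y y' : G) A B C D :
  face_list (x :: A ++ x' :: B ++ y :: C ++ y' :: D) ->
  bar G x = x' -> bar G y = y' ->
  let K := cut_open x y in
  [/\ conn G K, face_list (G := K) (x :: C ++ y' :: B ++ y :: A ++ x' :: D),
      [/\ bar K x = y', bar K y' = x, bar K y = x' & bar K x' = y]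
    & forall d, d \notin [:: x; x'; y; y'] -> bar K d = bar G d].
Proof.
move=> s_list bx by_; subst x' y' => K.
have xy : distinct_edges x y.
  have [U _ _] := s_list; split.
    move: U => /andP[+ _]; apply: contraNneq => ->.
    by rewrite !(mem_cat, inE) eqxx ?orbT.
  move: U; rewrite cons_uniq cat_uniq => /and4P[_ _ _] /=.
  case/andP=> + _; apply: contraNneq => ->.
  by rewrite !(mem_cat, inE) eqxx ?orbT.
have K_list := cut_face_list xy s_list.
split=> //.
- apply: conn_cut => //; first exact: face_list_one_faced s_list.
  exact: face_list_one_faced K_list.
- by rewrite cut_bar1 // cut_bar2 // cut_bar3 // cut_bar4.
- by move=> d; apply: cut_bar_out.
Qed.

Section Move.
Variables (G : collection) (a c : G).

(* The surgery on [a] and [c] puts the handle on [c]; it is undone by surgery on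
   the opposite sides [bar a] and [bar c], which leaves the handle there. *)
Lemma insert_move_uncrossed A B C D :
  face_list (a :: A ++ bar G a :: B ++ c :: C ++ bar G c :: D) ->
  conn (insert a) (insert c).
Proof.
move=> s_list; have G1 := face_list_one_faced s_list.
have [GK K_list [b1 b2 b3 b4] b5] := surgery s_list erefl erefl.
set K := cut_open a c in GK K_list b1 b2 b3 b4 b5 *.
have K1 : one_faced K := face_list_one_faced K_list.
have U4 : uniq [:: a; bar G a; c; bar G c].
  have [U _ _] := s_list.
  apply: subseq_uniq U; rewrite -![_ :: _ :: _]cat1s /= eqxx.
  apply: (cat_subseq (sub0seq A)) => /=; rewrite eqxx.
  apply: (cat_subseq (sub0seq B)) => /=; rewrite eqxx.
  by apply: (cat_subseq (sub0seq C)) => /=; rewrite eqxx sub0seq.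
have [n1 n2 n3 n4] : [/\ c != a, c != bar G a, bar G c != bar G a & bar G c != a].
  move: U4; rewrite /= !inE !negb_or -!andbA ![a == _]eq_sym ![bar G a == _]eq_sym.
  by case/and5P=> _ -> -> -> /andP[-> _].
have d1 : distinct_edges a c by [].
have d2 : @distinct_edges K (bar G a) (bar G c).
  by split=> //; rewrite b4 (bar_neq c).
pose L := @cut_open K (bar G a) (bar G c).
have LG d : bar L d = bar G d.
  have bL : bar K (bar G a) = c /\ bar K (bar G c) = a by [].
  have [->|da] := eqVneq d (bar G a).
    by rewrite (cut_bar1 d2) barK bL.2.
  have [->|dc] := eqVneq d (bar G c).
    by rewrite (cut_bar3 d2) barK bL.1.
  have [->|da'] := eqVneq d a.
    by have := cut_bar2 d2; rewrite bL.2.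
  have [->|dc'] := eqVneq d c.
    by have := cut_bar4 d2; rewrite bL.1.
  rewrite (cut_bar_out d2); last by rewrite !inE bL.1 bL.2 !negb_or da dc da' dc'.
  by rewrite b5 // !inE !negb_or da dc da' dc'.
have LGiso : iso L G by exists id; split=> //; exists id.
have L1 : one_faced L := iso_one_faced (iso_sym LGiso) G1.
have e1 := insert_cut a G1 d1 K1; rewrite tpermL in e1.
have e2 := insert_cut (c : K) K1 d2 L1; rewrite tpermD ?(bar_neq c) 1?eq_sym // in e2.
apply: conn_trans e1 (conn_trans e2 (conn_iso _)).
by apply: (@insert_iso L G id) => //; exists id.
Qed.

(* The four surgeries were found by a computer search among all pairings of the
   half-edges a, bar a, c, bar c, u0, ..., u3, v0, ..., v3. *)
Lemma insert_move_crossed A B C D :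
  face_list (a :: A ++ c :: B ++ bar G a :: C ++ bar G c :: D) ->
  conn (insert a) (insert c).
Proof.
move=> s_list; set a' := bar G a in s_list; set c' := bar G c in s_list.
have [n1 n2 n3 n4] : [/\ c != a, c != a', c' != a' & c' != a].
  have [U _ _] := s_list; have : uniq [:: a; c; a'; c'].
    apply: subseq_uniq U; rewrite /= eqxx.
    apply: (cat_subseq (sub0seq A)) => /=; rewrite eqxx.
    apply: (cat_subseq (sub0seq B)) => /=; rewrite eqxx.
    by apply: (cat_subseq (sub0seq C)) => /=; rewrite eqxx sub0seq.
  rewrite /= !inE !negb_or -!andbA ![a == _]eq_sym ![a' == _]eq_sym.
  by case/and5P=> -> _ -> -> /and3P[_ -> _].
have n5 : a' != a := bar_neq a.
have n6 : c' != c := bar_neq c.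
pose J : G -> insert a := inl.
pose U p : insert a := inr (gu p).
pose V p : insert a := inr (gv p).
have F0 := @insert_face_list G a (A ++ c :: B) (C ++ c' :: D).
rewrite -catA in F0; move/(_ s_list): F0; rewrite !map_cat -!catA /=.
rewrite -/J -/(U p0) -/(U p1) -/(U p2) -/(U p3) -/(V p0) -/(V p1) -/(V p2) -/(V p3).
(* From here on the four pieces are inert: only the cyclic order of the twelve named half-edges
   matters. *)
move: (map J A) (map J B) (map J C) (map J D) => {s_list}{}A {}B {}C {}D F0.
have b0 d : bar (insert a) d = ins_bar_fun a d by rewrite permE.
have F0' : face_list (G := insert a)
    (J c :: (B ++ J a' :: U p1 :: V p2 :: V p3 :: U p0 :: C) ++
     J c' :: (D ++ [:: J a]) ++ U p3 :: [:: V p0] ++ V p1 :: (U p2 :: A)).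
  by rotate_list (J a :: U p3 :: V p0 :: V p1 :: U p2 :: A) F0.
have [|//|c1 F1 b1 o1] := surgery F0'.
  by rewrite b0 /= (negPf n1) (negPf n2).
set K1 := cut_open _ _ in c1 F1 b1 o1 *.
have neq_inl (d e : G) : (J d == J e) = (d == e) by [].
have neqs := (negPf n1, negPf n2, negPf n3, negPf n4, negPf n5, negPf n6).
have neqs' := (eq_sym a c, eq_sym a' c, eq_sym a' c', eq_sym a c', eq_sym a a', eq_sym c c').
have {b1} [b1c b1v1 b1u3 b1c'] := b1.
have b1a' : bar K1 (J a') = U p2.
  by rewrite o1 ?b0 /= ?neqs' ?neqs ?eqxx // !inE !neq_inl ?neqs' ?neqs.
have b1a : bar K1 (J a) = U p0.
  by rewrite o1 ?b0 /= ?neqs' ?neqs ?eqxx // !inE !neq_inl ?neqs' ?neqs.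
have F1' : face_list (G := K1)
    (J c :: [:: V p0] ++ V p1 :: (D ++ J a :: U p3 :: B) ++
     J a' :: [:: U p1, V p2, V p3, U p0 & C ++ [:: J c']] ++ U p2 :: A).
  by move: F1; norm_cat.
have [//|//|c2 F2 [b2c b2u2 b2a' b2v1] o2] := surgery F1'.
set K2 := cut_open _ _ in c2 F2 b2c b2u2 b2a' b2v1 o2 *.
have b2a : bar K2 (J a) = U p0.
  by rewrite o2 // !inE !neq_inl ?neqs' ?neqs.
have F2' : face_list (G := K2)
    (J a' :: [:: V p0] ++ V p1 :: (A ++ [:: J c; U p1; V p2; V p3]) ++
     U p0 :: (C ++ J c' :: U p2 :: D) ++ J a :: U p3 :: B).
  by rotate_list (J c :: [:: U p1, V p2, V p3, U p0 & C ++ [:: J c']] ++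
    U p2 :: (D ++ J a :: U p3 :: B)) F2.
have [//| |c3 F3 [b3a' b3a b3u0 b3v1] o3] := surgery F2'.
  by rewrite -b2a barK.
set K3 := cut_open _ _ in c3 F3 b3a' b3a b3u0 b3v1 o3 *.
have b3u3 : bar K3 (U p3) = J c'.
  by rewrite o3 // o2 // -[LHS]b1u3.
have F3' : face_list (G := K3)
    (U p3 :: (B ++ J a' :: C) ++
     J c' :: [:: U p2 & D ++ J a :: A ++ [:: J c; U p1; V p2; V p3]] ++
     U p0 :: [:: V p0] ++ V p1 :: [::]).
  by rotate_list (J a' :: (C ++ J c' :: U p2 :: D) ++
    J a :: (A ++ [:: J c; U p1; V p2; V p3]) ++ U p0 :: [:: V p0; V p1]) F3.
have [//|//|c4 F4 [b4u3 b4v1 b4u0 b4c'] o4] := surgery F3'.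
set K4 := cut_open _ _ in c4 F4 b4u3 b4v1 b4u0 b4c' o4 *.
(* Darts and [node] are the same on both sides, so it suffices to compare the pairings. The handle
   sits on [c'], and a half-turn will bring it to [c]. *)
have K4E : iso K4 (insert c').
  exists id; split; [by exists id| |by []].
  suff K4b d : bar K4 d = ins_bar_fun c' d by move=> d; rewrite [in RHS]permE -K4b.
  have c'c : bar G c' = c by rewrite /c' barK.
  case: d => [d|[[] [[] []]]]; rewrite [RHS]/= ?c'c //;
    try by rewrite o4 // o3 // o2 // o1 // b0.
  have [->//|dc'] := eqVneq d c'.
    have [->|dc] := eqVneq d c.
      by rewrite o4 ?o3 ?b2c // !inE !neq_inl ?neqs' ?neqs.
    have [->|da] := eqVneq d a.
      by rewrite o4 ?b3a // !inE !neq_inl ?neqs' ?neqs.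
    have [->|da'] := eqVneq d a'.
      by rewrite o4 ?b3a' ?barK // !inE !neq_inl ?neqs' ?neqs.
    have neqd := (negPf dc', negPf dc, negPf da, negPf da').
    by rewrite o4 ?o3 ?o2 ?o1 ?b0 /= ?neqd // !inE !neq_inl ?neqd.
apply: conn_trans c1 (conn_trans c2 (conn_trans c3 (conn_trans c4 _))).
apply: conn_trans (conn_iso K4E) (conn_iso _).
by have := insert_iso_bar c'; rewrite barK.
Qed.

End Move.

(** The chords of [a] and [c] either cross or not. As [insert_iso_bar] allows either side of each
    edge to be used, every order of the four sides reduces to one of the two preceding lemmas. *)
Lemma insert_move (G : collection) (a c : G) :
  one_faced G -> conn (insert a) (insert c).
Proof.
move=> G1; have [s s_list] := face_list_exists a G1.
have flip b : conn (insert (bar G b)) (insert b).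
  exact/conn_sym/conn_iso/insert_iso_bar.
have mem_s d : d != a -> d \in s.
  by case: s_list => _ _ /(_ d); rewrite inE => /orP[/eqP->|//]; rewrite eqxx.
have [->|ca] := eqVneq c a; first exact: conn_refl.
have [->|cba] := eqVneq c (bar G a); first exact/conn_iso/insert_iso_bar.
have bca : bar G c != a by apply: contraNneq cba => <-; rewrite barK.
have bcba : bar G c != bar G a by rewrite (inj_eq perm_inj).
have bcc : bar G c != c := bar_neq c.
move: (mem_s c ca) (mem_s _ bca) s_list.
case/splitPr: (mem_s _ (bar_neq a)) => A B {mem_s}.
rewrite !mem_cat !inE (negPf cba) (negPf bcba) /= => /orP[] /splitPr[C D].
  rewrite mem_cat inE (negPf bcc) /= -orbA => /or3P[] /splitPr[E F]; rewrite -?catA /= => sl.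
  - apply: conn_trans (flip c).
    apply: conn_trans (conn_sym (flip a)) _.
    apply: (@insert_move_uncrossed _ _ _ B E F D); rewrite !barK.
    by apply: (face_list_rotE (s1 := a :: E ++ bar G c :: F ++ c :: D) (s2 := bar G a :: B) sl);
       norm_cat.
  - apply: conn_trans (conn_sym (flip a)) _.
    apply: (@insert_move_uncrossed _ _ _ B C E F); rewrite !barK.
    by apply: (face_list_rotE (s1 := a :: C ++ c :: E ++ bar G c :: F) (s2 := bar G a :: B) sl);
       norm_cat.
  - exact: insert_move_crossed sl.
rewrite mem_cat inE (negPf bcc) /= => /or3P[] /splitPr[E F]; rewrite -?catA /= => sl.
- apply: conn_trans (flip c).
  by apply: (insert_move_crossed (A := E) (B := F) (C := C) (D := D)); rewrite barK.
- apply: conn_trans (flip c).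
  by apply: (insert_move_uncrossed (A := A) (B := E) (C := F) (D := D)); rewrite barK.
- exact: insert_move_uncrossed sl.
Qed.

(** * Removing a handle *)

Definition turn (G : collection) (d : G) (p : bool * bool) : G :=
  match p with
  | p0 => d | p1 => node G d | p2 => node G (node G d)
  | (true, false) => node G (node G (node G d)) end.

Definition vertex_darts (G : collection) (d : G) : seq G :=
  [:: d; node G d; node G (node G d); node G (node G (node G d))].

Section Remove.
Variables (G : collection) (u v : G).
Hypothesis G1 : one_faced G.
Hypothesis uv : v \notin vertex_darts u.
Let n := node G.
Hypothesis vv : bar G v = n (n v).
Hypothesis uv1 : bar G (n u) = n (n (n v)).
Hypothesis uv3 : bar G (n (n (n u))) = n v.

Let handle := vertex_darts u ++ vertex_darts v.

Lemma vertex_darts_node d e : (n e \in vertex_darts d) = (e \in vertex_darts d).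
Proof.
rewrite -[RHS](mem_map (@perm_inj _ n)) /= !inE node4.
by case: (_ == d); rewrite ?orbT ?orbF.
Qed.

Lemma uniq_handle : uniq handle.
Proof.
rewrite cat_uniq !node_uniq andbT -all_predC /= !vertex_darts_node.
by rewrite uv.
Qed.

Lemma handle_node d : (n d \in handle) = (d \in handle).
Proof. by rewrite !mem_cat !vertex_darts_node. Qed.

(** These six half-edges of the handle are paired among themselves; the remaining two, [u] and
    [n (n u)], are the legs that tie it to the rest. *)
Let inner := [:: n u; n (n (n u)); v; n v; n (n v); n (n (n v))].

Lemma perm_handle : perm_eq handle ([:: u; n (n u)] ++ inner).
Proof.
rewrite perm_cons; apply/permPl.
exact: (perm_catCA [:: n u] [:: n (n u)] (n (n (n u)) :: vertex_darts v)).
Qed.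

Lemma mem_handle d : (d \in handle) = [|| d == u, d == n (n u) | d \in inner].
Proof.
by rewrite (perm_mem perm_handle) mem_cat !inE -!orbA.
Qed.

Lemma inner_legs : (u \notin inner) && (n (n u) \notin inner) && (u != n (n u)).
Proof.
have := uniq_handle; rewrite (perm_uniq perm_handle) /= inE negb_or -/n.
by case/and3P=> /andP[-> ->] ->.
Qed.

Lemma inner_bar d : (bar G d \in inner) = (d \in inner).
Proof.
have sub e : e \in inner -> bar G e \in inner.
  have bv := canRL (@barK G) vv; have b1 := canRL (@barK G) uv1.
  have b3 := canRL (@barK G) uv3; rewrite !inE.
  by case/or4P=> [||| /or3P[]] /eqP->; rewrite ?uv1 ?uv3 ?vv -?bv -?b1 -?b3 eqxx ?orbT.
by apply/idP/idP=> /sub //; rewrite barK.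
Qed.

Lemma handle_bar d : bar G d \in handle ->
  [|| d == bar G u, d == bar G (n (n u)) | d \in handle].
Proof.
rewrite !mem_handle inner_bar !(can2_eq (@barK G) (@barK G)).
by case/or3P=> ->; rewrite ?orbT.
Qed.

(* Otherwise u0, u1, v2, v3 would be a whole face. *)
Lemma leg_neq : bar G u != n (n u).
Proof.
have /andP[/andP[nu nu2] nuu] := inner_legs; apply/negP=> /eqP u02.
pose P : pred G := [in [:: u; n u; n (n v); n (n (n v))]].
suff : P (n (n u)).
  rewrite /P /= !inE; apply/negP; rewrite !negb_or; move: nu2 nuu.
  by rewrite !inE !negb_or [u == _]eq_sym => /and5P[-> _ _ _ /andP[-> ->]] ->.
have Pg d e : bar G d = n e -> P e -> P (face G d) by move=> /face_eq ->.
apply: (@one_faced_ind G u P G1) => [d|]; last by rewrite /P /= mem_head.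
rewrite {1}/P /= !inE => /or4P[] /eqP->.
- by apply: Pg u02 _; rewrite /P /= !inE eqxx ?orbT.
- by apply: Pg uv1 _; rewrite /P /= !inE eqxx ?orbT.
- apply: (Pg _ (n (n (n v)))); last by rewrite /P /= !inE eqxx ?orbT.
  by rewrite /n node4 -/n -vv barK.
- apply: (Pg _ u); last by rewrite /P /= !inE eqxx ?orbT.
  by rewrite -uv1 barK.
Qed.

Lemma leg1 : bar G u \notin handle.
Proof.
have /andP[/andP[nu nu2] nuu] := inner_legs.
by rewrite mem_handle inner_bar (negPf nu) (negPf leg_neq) (negPf (bar_neq u)).
Qed.

Lemma leg2 : bar G (n (n u)) \notin handle.
Proof.
have /andP[/andP[nu nu2] nuu] := inner_legs.
rewrite mem_handle inner_bar (negPf nu2) (negPf (bar_neq _)) !orbF.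
by rewrite (can2_eq (@barK G) (@barK G)) eq_sym leg_neq.
Qed.

Let rest := {d : G | d \notin handle}.

Let rnode (d : rest) : rest := exist _ (n (val d)) (etrans (congr1 negb (handle_node _)) (valP d)).

(** The outer ends of the two legs become the two halves of one edge, which restores the strand that
    passed through [u]. *)
Definition rbar_fun (d : G) : G :=
  if d == bar G u then bar G (n (n u)) else
  if d == bar G (n (n u)) then bar G u else bar G d.

Lemma rbar_subproof (d : rest) : rbar_fun (val d) \notin handle.
Proof.
rewrite /rbar_fun; case: eqP => [_|/eqP da]; first exact: leg2.
case: eqP => [_|/eqP db]; first exact: leg1.
apply: contra (valP d) => /handle_bar.
by rewrite (negPf da) (negPf db).
Qed.

Let rbar (d : rest) : rest := exist _ (rbar_fun (val d)) (rbar_subproof d).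

Lemma rnode_inj : injective rnode.
Proof. by move=> d e /(congr1 val) /= /perm_inj /val_inj. Qed.

Lemma rbarK : involutive rbar.
Proof.
move=> d; apply: val_inj; rewrite /= /rbar_fun.
have /andP[/andP[nu nu2] nuu] := inner_legs.
case: (val d =P bar G u) => [->|/eqP da].
  by rewrite (inj_eq (@bar_inj G)) eq_sym (negPf nuu) eqxx.
case: (val d =P bar G (n (n u))) => [->|/eqP db]; first by rewrite eqxx.
have := valP d; rewrite mem_handle => /norP[du /norP[du2 _]].
by rewrite !(inj_eq (@bar_inj G)) (negPf du) (negPf du2) barK.
Qed.

Lemma rbar_neq d : perm (inv_inj rbarK) d != d.
Proof.
rewrite permE -(inj_eq val_inj) /= /rbar_fun.
have /andP[_ nuu] := inner_legs.
case: (val d =P bar G u) => [->|/eqP da].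
  by rewrite (inj_eq (@bar_inj G)) eq_sym.
case: (val d =P bar G (n (n u))) => [->|/eqP db]; last exact: bar_neq.
by rewrite (inj_eq (@bar_inj G)).
Qed.

Lemma rbarK' : involutive (perm (inv_inj rbarK)).
Proof. by move=> d; rewrite !permE rbarK. Qed.

Lemma rnode_4valent d : #|porbit (perm rnode_inj) d| = 4.
Proof.
apply: card_porbit4; rewrite !permE; first by apply: val_inj; rewrite /= node4.
by rewrite -(map_inj_uniq val_inj); apply: node_uniq.
Qed.

Definition remove : collection := Collection rnode_4valent rbarK' rbar_neq.

Let leg : remove := exist _ (bar G u) leg1.

Lemma remove_insert : iso (insert leg) G.
Proof.
pose h (d : insert leg) : G := match d with
  | inl d => val d
  | inr (s, p) => turn (if s then v else u) p end.
have h_handle q : h (inr q) \in handle.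
  case: q => -[[[] []]|[[] []]]; by rewrite /h /= !inE eqxx ?orbT.
have h_inj : injective h.
  have notin (d : remove) q : h (inl d) <> h (inr q).
    by move=> e; have := valP d; rewrite -[val d]/(h (inl d)) e h_handle.
  have U := uniq_handle.
  move=> [d|q] [e|r] E.
  - by congr inl; apply: val_inj.
  - by case: (notin _ _ E).
  - by case: (notin _ _ (esym E)).
  (* [idx] decodes 00, 01, 11, 10 into the ranks 0, 1, 2, 3 around a vertex, with the vertex [v]
     listed after [u]; injectivity then follows from [uniq_handle]. *)
  - pose idx (q : gadget) := q.1 * 4 + q.2.1 * 2 + (q.2.1 (+) q.2.2).
    have hE q' : h (inr q') = nth u handle (idx q') by case: q' => -[[[] []]|[[] []]].
    have idxP q' : idx q' < size handle by case: q' => -[[[] []]|[[] []]].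
    move/eqP: E; rewrite !hE nth_uniq // => /eqP.
    by case: q => -[[[] []]|[[] []]]; case: r => -[[[] []]|[[] []]].
have bar_leg : bar remove leg = exist _ (bar G (n (n u))) leg2.
  by apply: val_inj; rewrite permE /= /rbar_fun eqxx.
exists h; split.
- apply: (inj_card_bij h_inj).
  rewrite card_sum !card_prod card_bool card_sig.
  rewrite -(cardC (mem handle)) (card_uniqP uniq_handle) addnC leq_add2r.
  by apply/eq_leq/eq_card => d; rewrite !inE.
- move=> d; rewrite permE.
  have legE (e : remove) (x : G) p : (e == exist _ x p :> remove) = (val e == x) by [].
  case: d => [d|[[] [[] []]]]; rewrite /= ?vv ?uv1 ?uv3 ?barK ?bar_leg //.
  + rewrite !legE permE.
    case: (val d =P bar G u) => [->|/eqP/negPf da]; first by rewrite /= barK.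
    case: (val d =P bar G (n (n u))) => [->|/eqP/negPf db]; first by rewrite /= barK.
    by rewrite /= /rbar_fun da db.
  + exact: canRL (@barK G) vv.
  + exact: canRL (@barK G) uv1.
  + exact: canRL (@barK G) uv3.
- by move=> d; rewrite permE; case: d => [d|[[] [[] []]]]; rewrite /= ?permE ?node4.
Qed.

End Remove.

(** * Creating a closed curve with one vertex *)

(** [w] is paired with the half-edge opposite to it, so the curve through [w] closes up after its
    first vertex. *)
Definition reach_loop (G : collection) : Prop :=
  exists2 K, conn G K & exists w : K, bar K w = node K (node K w).

Lemma reach_loop_conn G K : conn G K -> reach_loop K -> reach_loop G.
Proof. by move=> GK [L KL loop]; exists L => //; apply: conn_trans KL. Qed.

Lemma reach_loop_refl (G : collection) (w : G) :
  bar G w = node G (node G w) -> reach_loop G.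
Proof. by move=> loop; exists G; [apply: conn_refl|exists w]. Qed.

Lemma face_list_gap (G : collection) s1 (d e : G) s2 s3 :
  face_list (s1 ++ d :: s2 ++ e :: s3) -> bar G (last d s2) = node G e.
Proof.
case/lastP: s2 => [|s2 x]; first exact: face_list_bar.
rewrite last_rcons cat_rcons => sl.
by apply: (@face_list_bar _ (s1 ++ d :: s2) _ _ s3); rewrite -catA.
Qed.

(** Write w0, ..., w3 for the half-edges around the vertex. The side preceding w1 is bar w2, and the
    side preceding w3 is bar w0. In the order w0, w2, w1, w3 the chords of w0 and w2 therefore do
    not cross, and the surgery on them pairs w0 with w2. *)
Lemma reach_loop_interlaced (G : collection) (w : G) P Q R S :
  face_list (w :: P ++ node G (node G w) :: Q ++ node G w :: R ++
             node G (node G (node G w)) :: S) -> reach_loop G.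
Proof.
set w1 := node G w; set w2 := node G w1; set w3 := node G w2 => sl.
have b2 : bar G (last w2 Q) = w2.
  by apply: (@face_list_gap _ (w :: P) _ _ Q (R ++ w3 :: S)).
have b0 : bar G (last w1 R) = w.
  rewrite -[RHS]node4; apply: (@face_list_gap _ (w :: P ++ w2 :: Q) _ _ R S).
  by rewrite /= -catA.
case/lastP: Q => [|Q q2] in b2 sl; first by move/eqP: b2; rewrite (negPf (bar_neq _)).
rewrite last_rcons in b2; move: sl b0.
rewrite -[w1 :: R ++ w3 :: S]cat_cons (lastI w1 R); move: (belast _ _) (last _ _) => R' q0 sl b0.
have [|//||c _ [_ _ b _] _] := @surgery G q0 w w2 q2 (w3 :: S) P Q R'.
- by rotate_list (w :: P ++ w2 :: rcons Q q2 ++ R') sl.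
- by rewrite -b2 barK.
- by exists (cut_open q0 w2) => //; exists w2; rewrite b [RHS]node4.
Qed.

Definition cyclic_vertex (G : collection) (v : G) X Y Z W : Prop :=
  face_list (v :: X ++ node G v :: Y ++ node G (node G v) :: Z ++
             node G (node G (node G v)) :: W).

Section CyclicVertex.
Variable G : collection.
Implicit Types (v : G) (X Y Z W : seq G).

Lemma cyclic_vertex_rot v X Y Z W :
  cyclic_vertex v X Y Z W -> cyclic_vertex (node G v) Y Z W X.
Proof.
move=> sl; rewrite /cyclic_vertex node4 in sl *.
by rotate_list (v :: X) sl.
Qed.

Lemma cyclic_vertex_empty v X Y W : cyclic_vertex v X Y [::] W -> reach_loop G.
Proof.
move=> sl; apply: (@reach_loop_refl _ (node G (node G v))).
by apply: (@face_list_bar _ (v :: X ++ node G v :: Y) _ _ W); rewrite /= -catA.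
Qed.

Lemma cyclic_vertex_last v X Y Z p W : cyclic_vertex v X Y (rcons Z p) W -> bar G p = v.
Proof.
move=> sl; rewrite -[RHS]node4.
apply: (@face_list_bar _ (v :: X ++ node G v :: Y ++ node G (node G v) :: Z) _ _ W).
by move: sl; rewrite /cyclic_vertex cat_rcons; norm_cat.
Qed.

(** The chord of [v] ends at the last side of [Z]. Surgery on it and on the chord of [y] makes the
    face meet the vertex in the order v2, v0, v3, v1, which is interlaced. *)
Lemma reach_loop_chord_same v X Y Z W1 y W2 W3 :
  cyclic_vertex v X Y Z (W1 ++ y :: W2 ++ bar G y :: W3) -> reach_loop G.
Proof.
case/lastP: Z => [|Z p] sl; first exact: cyclic_vertex_empty sl.
have bp := cyclic_vertex_last sl; rewrite /cyclic_vertex cat_rcons in sl.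
set v1 := node G v in sl *; set v2 := node G v1 in sl *; set v3 := node G v2 in sl *.
have [| |//|c kl _ _] := @surgery G v p y (bar G y) (X ++ v1 :: Y ++ v2 :: Z) (v3 :: W1) W2 W3.
- by move: sl; norm_cat.
- by rewrite -bp barK.
apply: (reach_loop_conn c).
apply: (@reach_loop_interlaced (cut_open v y) v2
  (Z ++ p :: W3) (W2 ++ [:: bar G y]) (W1 ++ y :: X) Y).
rewrite [node (cut_open v y)]/= node4.
by rotate_list (v :: W2 ++ bar G y :: v3 :: W1 ++ y :: X ++ v1 :: Y) kl.
Qed.

(** Surgery on the chord of [v], taken at its other end [p], and on the chord of [y] yields the
    interlaced order v0, v2, v1, v3. *)
Lemma reach_loop_chord_next v X1 y X2 Y1 Y2 Z W :
  cyclic_vertex v (X1 ++ y :: X2) (Y1 ++ bar G y :: Y2) Z W -> reach_loop G.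
Proof.
case/lastP: Z => [|Z p] sl; first exact: cyclic_vertex_empty sl.
have bp := cyclic_vertex_last sl; rewrite /cyclic_vertex cat_rcons in sl.
set v1 := node G v in sl *; set v2 := node G v1 in sl *; set v3 := node G v2 in sl *.
have [|//|//|c kl _ _] := @surgery G p v y (bar G y) (v3 :: W) X1 (X2 ++ v1 :: Y1) (Y2 ++ v2 :: Z).
- by rotate_list (v :: X1 ++ y :: X2 ++ v1 :: Y1 ++ bar G y :: Y2 ++ v2 :: Z) sl.
apply: (reach_loop_conn c).
apply: (@reach_loop_interlaced (cut_open p y) v
  Y2 (Z ++ p :: X2) (Y1 ++ bar G y :: X1 ++ [:: y]) W).
rewrite [node (cut_open p y)]/=.
by rotate_list (p :: X2 ++ v1 :: Y1 ++ bar G y :: X1 ++ y :: v3 :: W) kl.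
Qed.

(** The side just before [e] is paired with [node G e]. If its chord does not lead to [Z], it stays
    in [X] or leads to one of the neighbouring gaps [Y] and [W], and one of the two preceding lemmas
    applies, up to rotation. If [e] is first in [X], that side is [v], whose chord ends [Z]. *)
Lemma cyclic_vertex_cross v X Y Z W e :
  cyclic_vertex v X Y Z W -> e \in X -> reach_loop G \/ node G e \in Z.
Proof.
move=> sl eX; have ev : e \notin vertex_darts v.
  have [U _ _] := sl; apply: contraL eX => ev.
  have pe : perm_eq (v :: X ++ node G v :: Y ++ node G (node G v) :: Z ++
      node G (node G (node G v)) :: W) (vertex_darts v ++ X ++ (Y ++ Z ++ W)).
    by rewrite /vertex_darts; move: (node G v) => v1; move: (node G v1) => v2;
      move: (node G v2) => v3; count_perm.
  move: U; rewrite (perm_uniq pe) cat_uniq => /and3P[_ /hasPn dis _].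
  by apply/negP=> eX; have := dis e; rewrite mem_cat eX ev => /(_ isT).
have all_d d : d \notin vertex_darts v -> [\/ d \in X, d \in Y, d \in Z | d \in W].
  have [_ _ /(_ d)] := sl; rewrite !(inE, mem_cat) !negb_or.
  move=> all_d /and4P[/negPf n0 /negPf n1 /negPf n2 /negPf n3].
  move: all_d; rewrite n0 n1 n2 n3 /=.
  by case/or4P=> H; [apply: Or41|apply: Or42|apply: Or43|apply: Or44].
case/splitPr: eX sl all_d => X1 X2; case/lastP: X1 => [|X1 d] sl all_d.
  have bv : bar G v = node G e by apply: (@face_list_bar _ [::] _ _ _ sl).
  case/lastP: Z => [|Z p] in sl all_d *; first by left; apply: cyclic_vertex_empty sl.
  by right; rewrite -bv -(cyclic_vertex_last sl) barK mem_rcons mem_head.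
have bd : bar G d = node G e.
  apply: (@face_list_bar _ (v :: X1)); move: sl; rewrite /cyclic_vertex.
  by norm_cat; apply.
rewrite cat_rcons in sl all_d; rewrite -bd.
have [|dX|dY|dZ|dW] := all_d (bar G d).
- by rewrite bd vertex_darts_node.
- left; have := cyclic_vertex_rot sl; move: (e :: X2) dX => B.
  rewrite mem_cat inE (negPf (bar_neq d)) /= => /orP[] /splitPr[C D] sl1.
    apply: (@reach_loop_chord_same (node G v) Y Z W C (bar G d) D B); rewrite barK.
    by move: sl1; rewrite -catA /=; apply.
  exact: reach_loop_chord_same sl1.
- by left; case/splitPr: dY sl => Y1 Y2 sl; apply: reach_loop_chord_next sl.
- by right.
left; have := cyclic_vertex_rot (cyclic_vertex_rot (cyclic_vertex_rot sl)).
case/splitPr: dW => W1 W2; rewrite -{2}(barK d) => sl3.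
exact: reach_loop_chord_next sl3.
Qed.

Lemma cyclic_vertex_rot2 v X Y Z W :
  cyclic_vertex v X Y Z W -> cyclic_vertex (node G (node G v)) Z W X Y.
Proof. by move/cyclic_vertex_rot/cyclic_vertex_rot. Qed.

Lemma split_pair (T : eqType) (s : seq T) x y : x \in s -> y \in s -> x != y ->
  exists s1 s2 s3, s = s1 ++ x :: s2 ++ y :: s3 \/ s = s1 ++ y :: s2 ++ x :: s3.
Proof.
case/splitPr=> s1 s2; rewrite mem_cat inE => + /negPf xy.
rewrite eq_sym xy => /orP[] /splitPr[s3 s4].
  by exists s3, s4, s2; right; rewrite -catA.
by exists s1, s3, s4; left.
Qed.

Lemma cyclic_vertex_crossP v X Y Z W :
  cyclic_vertex v X Y Z W -> reach_loop G \/ {in X, forall e, node G e \in Z}.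
Proof.
move=> sl; case: (allP (a := fun e => node G e \in Z) (s := X)) => [|notX].
  by right.
left; have /allPn[e eX neZ] : ~~ all (fun e => node G e \in Z) X by apply/allP.
by case: (cyclic_vertex_cross sl eX) => // eZ; rewrite eZ in neZ.
Qed.

(* If every edge leaving X ends in Z and conversely, then the half-edges of a
   vertex meeting X alternate between X and Z, hence they are interlaced. *)
Lemma cyclic_vertex_reach_loop v X Y Z W : cyclic_vertex v X Y Z W -> reach_loop G.
Proof.
move=> sl; have sl2 := cyclic_vertex_rot2 sl.
have [//|crossX] := cyclic_vertex_crossP sl.
have [//|crossZ] := cyclic_vertex_crossP sl2.
have [X0|[u0 x0]] : X = [::] \/ exists u0, u0 \in X.
- by case: (X) => [|u0 X']; [left|right; exists u0; apply: mem_head].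
- by rewrite X0 in sl2; apply: cyclic_vertex_empty sl2.
(* [u0] and its opposite both lie in [X]; the one met first is taken as [u0]. *)
wlog [X1 [X2 [X3 defX]]] : u0 x0 / exists X1 X2 X3,
    X = X1 ++ u0 :: X2 ++ node G (node G u0) :: X3.
  have x2 := crossZ _ (crossX _ x0) => wl.
  have [|X1 [X2 [X3 [] defX]]] := split_pair x0 x2.
  - by have := node_uniq u0; rewrite /= !inE !negb_or => /andP[/and3P[_ ->]].
  - by apply: (wl u0) => //; exists X1, X2, X3.
  - by apply: (wl _ x2); exists X1, X2, X3; rewrite node4.
have z1 := crossX _ x0; have x2 := crossZ _ z1; have z3 := crossX _ x2.
have [|Z1 [Z2 [Z3 [] defZ]]] := split_pair z1 z3.
- by have := node_uniq (node G u0); rewrite /= !inE !negb_or => /andP[/and3P[_ ->]].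
- apply: (@reach_loop_interlaced _ u0 X2 (X3 ++ node G v :: Y ++ node G (node G v) :: Z1) Z2
    (Z3 ++ node G (node G (node G v)) :: W ++ v :: X1)).
  by move: sl; rewrite /cyclic_vertex defX defZ => sl; rotate_list (v :: X1) sl.
(* Here u3 comes before u1 in [Z]: the cyclic order u3, u1, u0, u2 is interlaced when read from
   u3. *)
apply: (@reach_loop_interlaced _ (node G (node G (node G u0))) Z2
  (Z3 ++ node G (node G (node G v)) :: W ++ v :: X1) X2
  (X3 ++ node G v :: Y ++ node G (node G v) :: Z1)).
rewrite !node4; move: sl; rewrite /cyclic_vertex defX defZ => sl.
by rotate_list (v :: X1 ++ u0 :: X2 ++ node G (node G u0) :: X3 ++ node G v :: Y ++
  node G (node G v) :: Z1) sl.
Qed.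

End CyclicVertex.

Lemma split_index (T : eqType) (s : seq T) b : b \in s -> exists s1 s2,
  s = s1 ++ b :: s2 /\
  forall a, index a s < index b s -> a \in s1 /\ index a s1 = index a s.
Proof.
move=> bs; exists (take (index b s) s), (drop (index b s).+1 s).
have defs : s = take (index b s) s ++ b :: drop (index b s).+1 s.
  by rewrite -[in LHS](cat_take_drop (index b s) s) (drop_nth b) ?index_mem // nth_index.
split=> // a ab; have as_ : a \in s.
  by rewrite -index_mem (leq_trans ab) // ltnW // index_mem.
have at_ : a \in take (index b s) s by rewrite in_take.
by split=> //; rewrite [in RHS]defs index_cat at_.
Qed.

Section Index.
Variables (G : collection) (x : G) (s : seq G).
Hypothesis sl : face_list (x :: s).
Notation t d := (index d (x :: s)).

Lemma face_index_inj (d e : G) : t d = t e -> d = e.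
Proof.
have [_ _ all_s] := sl => tde.
by rewrite -(nth_index x (all_s d)) tde nth_index.
Qed.

Lemma face_index_succ (d e : G) : bar G d = node G e -> e != x -> t e = (t d).+1.
Proof.
have [U cyc all_s] := sl; move=> de ex.
have [s1 [s2 [defs _]]] := split_index (all_s d); have sl' := sl.
case: s2 => [|b s2] in defs.
  have := face_list_bar_last sl; rewrite -[last x s]/(last x (x :: s)) defs last_cat /=.
  by rewrite de => /node_inj ex'; rewrite ex' eqxx in ex.
rewrite defs in sl' U *; have := face_list_bar sl'; rewrite de => /node_inj eb.
have nth_d : nth x (s1 ++ d :: b :: s2) (size s1) = d by rewrite nth_cat ltnn subnn.
have nth_e : nth x (s1 ++ d :: b :: s2) (size s1).+1 = e.
  by rewrite nth_cat ltnNge leqnSn subSnn /= eb.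
have sz : (size s1).+1 < size (s1 ++ d :: b :: s2) by rewrite size_cat /=; lia.
by have := index_uniq x sz U; have := index_uniq x (ltnW sz) U; rewrite nth_d nth_e => -> ->.
Qed.

Lemma face_index_last (d : G) : bar G d = node G x -> t d = size s.
Proof.
have [U _ _] := sl; rewrite -(face_list_bar_last sl) => /bar_inj ->.
by rewrite index_last.
Qed.

Lemma face_index_le (d : G) : t d <= size s.
Proof. by have [_ _ all_s] := sl; have := all_s d; rewrite -index_mem. Qed.

End Index.

(* In position along the face, [bar] goes up for half of the sides; as [node]
   goes down more rarely, it goes down at most once around some vertex. *)
Lemma cyclic_vertex_exists (G : collection) : one_faced G ->
  exists (v : G) X Y Z W, cyclic_vertex v X Y Z W.
Proof.
move=> G1; have [x _] := one_faced_inhabited G1; have [s sl] := face_list_exists x G1.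
have [U _ all_s] := sl; pose t d := index d (x :: s).
have t_inj d e : t d = t e -> d = e by apply: (face_index_inj sl).
pose n := node G.
pose F e : nat := t (n e) < t e.
pose B d : nat := t d < t (bar G d).
have neq_bar d : t d != t (bar G d).
  by apply: contraNneq (bar_neq d) => /t_inj <-.
(* [n e] precedes [e] along the face iff it precedes [bar (n e)], the side just
   before [e], except when [e] is the first side. *)
have FB e : F e <= B (n e).
  have [->|ex] := eqVneq e x; first by rewrite /F /t /= eqxx ltn0.
  have := @face_index_succ _ _ _ sl (bar G (n e)) e; rewrite barK => /(_ erefl ex).
  rewrite -!/(t _) /F /B => ->; have := neq_bar (n e); lia.
(* Strictness comes from the first side: nothing precedes [x], whereas [bar G (n x)] is the last
   side and so comes after [n x]. *)
have FBx : F x < B (n x).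
  have := @face_index_last _ _ _ sl (bar G (n x)); rewrite barK => /(_ erefl).
  have := face_index_le sl (n x); rewrite -!/(t _) /B => le_s tE.
  have := neq_bar (n x); rewrite tE => neq; rewrite /F {2}/t /= eqxx ltn0.
  by lia.
have ltFB : \sum_e F e < \sum_d B d.
  rewrite [X in _ < X](reindex_inj (@perm_inj _ n)) /=.
  by rewrite (bigD1 x) // [X in _ < X](bigD1 x) //= -addSn leq_add // leq_sum.
have sumB : (\sum_d B d) * 2 = #|G|.
  rewrite muln2 -addnn {2}(reindex_inj (@bar_inj G)) -big_split /= -sum1_card.
  by apply: eq_bigr => d _; rewrite /B barK; have := neq_bar d; lia.
(* Summed over all [e], the left side counts each descent four times; the total is below [2 * #|G|],
   so some term is below the average 2. *)
have [e lt2] : exists e, F e + F (n e) + F (n (n e)) + F (n (n (n e))) < 2.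
  apply/existsP; apply: contraLR (ltFB) => /existsPn ge2; rewrite -leqNgt.
  have : \sum_(e : G) 2 <= \sum_e (F e + F (n e) + F (n (n e)) + F (n (n (n e)))).
    by apply: leq_sum => e _; rewrite leqNgt.
  have shift H : \sum_e H e = \sum_e H (n e) by rewrite (reindex_inj (@perm_inj _ n)).
  have -> : \sum_(e : G) 2 = #|G| * 2 by rewrite sum_nat_const.
  rewrite !big_split /= -(shift (fun e => F (n (n e)))).
  rewrite -(shift (fun e => F (n e))) -(shift F); move: sumB ltFB.
  by move: (\sum_e F e) (\sum_d B d) #|G|; lia.
(* With at most one descent around the vertex, start just after it. *)
have {lt2} [v [l1 l2 l3]] : exists v,
    [/\ t v < t (n v), t (n v) < t (n (n v)) & t (n (n v)) < t (n (n (n v)))].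
  have neq d e' : d != e' -> t d != t e' by apply: contraNneq => /t_inj ->.
  have := node_uniq e; rewrite /= !inE !negb_or -!andbA -/n.
  case/and5P=> /neq n1 /neq n2 /neq n3 /neq n4 /and3P[/neq n5 /neq n6 _].
  move: lt2; rewrite /F [in X in _ + X]/n node4 -/n => lt2.
  have [a1|a1] := ltnP (t e) (t (n e)); last first.
    by exists (n e); rewrite /n node4 -/n; split; lia.
  have [a2|a2] := ltnP (t (n e)) (t (n (n e))); last first.
    by exists (n (n e)); rewrite /n !node4 -/n; split; lia.
  have [a3|a3] := ltnP (t (n (n e))) (t (n (n (n e)))); last first.
    by exists (n (n (n e))); rewrite /n !node4 -/n; split; lia.
  by exists e.
have [S2 [W [defs3 sub3]]] := split_index (all_s (n (n (n v)))).
have [v2S2 t2] := sub3 _ l3.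
have [S1 [Z [defs2 sub2]]] := split_index v2S2.
have [v1S2 t1] := sub3 _ (ltn_trans l2 l3).
have [v0S2 t0] := sub3 _ (ltn_trans l1 (ltn_trans l2 l3)).
have {t2 t1 t0} [l1' l2'] : index v S2 < index (n v) S2 /\ index (n v) S2 < index (n (n v)) S2.
  by rewrite t0 t1 t2.
have [v1S1 t1] := sub2 _ l2'; have [v0S1 t0] := sub2 _ (ltn_trans l1' l2').
have [S0 [Y [defs1 sub1]]] := split_index v1S1.
have [v0S0 _] : v \in S0 /\ index v S0 = index v S1 by apply: sub1; rewrite t0 t1.
case/splitPr: v0S0 defs1 => V X defs1.
exists v, X, Y, Z, (W ++ V); rewrite /cyclic_vertex; move: sl.
rewrite defs3 defs2 defs1 => sl'.
by rotate_list V sl'.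
Qed.

(** * Creating a handle *)

Definition reach_insert (G : collection) : Prop :=
  exists (H : collection) (a : H), conn G (insert a).

Lemma reach_insert_conn G K : conn G K -> reach_insert K -> reach_insert G.
Proof. by move=> GK [H [a KH]]; exists H, a; apply: conn_trans KH. Qed.

Lemma handle_reach_insert (G : collection) (u v : G) : one_faced G ->
  v \notin vertex_darts u -> bar G v = node G (node G v) ->
  bar G (node G u) = node G (node G (node G v)) ->
  bar G (node G (node G (node G u))) = node G v -> reach_insert G.
Proof.
move=> G1 vu b0 b1 b3; exists (remove G1 vu b0 b1 b3); eexists.
exact/conn_sym/conn_iso/remove_insert.
Qed.

Lemma vertex_darts_sym (G : collection) (d e : G) :
  (d \in vertex_darts e) = (e \in vertex_darts d).
Proof.
have sub (x y : G) : x \in vertex_darts y -> y \in vertex_darts x.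
  by rewrite !inE => /or4P[] /eqP->; rewrite ?node4 eqxx ?orbT.
by apply/idP/idP; apply: sub.
Qed.

Lemma vertex_darts_trans (G : collection) (d e f : G) :
  d \in vertex_darts e -> e \in vertex_darts f -> d \in vertex_darts f.
Proof.
have := vertex_darts_node f; move: (vertex_darts f) => s sP + es.
by rewrite /vertex_darts !in_cons orbF => /or4P[] /eqP->; rewrite ?sP.
Qed.

Section Loop.
Variables (G : collection) (v : G).
Let n := node G.
Hypothesis loop : bar G v = n (n v).

(** Writing v2 and v3 for the last two half-edges at [v], the sides bar v3, v2, v3 are consecutive
    on the face, because v2 is paired with [v]. The chord of v3 thus encloses only v2 and crosses no
    chord other than that of v2; read from v3, any other edge whose side [y] comes first can be cut
    so as to pair [y] with v3. *)
Lemma loop_surgery s (y : G) :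
  face_list (n (n (n v)) :: s) ->
  {in [:: y; bar G y], forall d, d \notin [:: n (n v); n (n (n v)); bar G (n (n (n v)))]} ->
  index y (n (n (n v)) :: s) < index (bar G y) (n (n (n v)) :: s) ->
  let K := cut_open (bar G (n (n (n v)))) y in
  [/\ conn G K, bar K (n (n (n v))) = y &
    forall d, d \notin [:: bar G (n (n (n v))); n (n (n v)); y; bar G y] -> bar K d = bar G d].
Proof.
set v3 := n (n (n v)); move=> sl out lt_y.
have [_ _ all_s] := sl.
have : y \notin [:: n (n v); v3; bar G v3] by apply: out; rewrite inE eqxx.
have : bar G y \notin [:: n (n v); v3; bar G v3] by apply: out; rewrite !inE eqxx orbT.
rewrite !inE !negb_or => /and3P[by2 by3 byp] /and3P[y2 y3 yp].
have lastv : last v3 s = n (n v).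
  have := face_list_bar_last sl; rewrite /v3 /n node4 => /(canRL (@barK G)) ->.
  by rewrite -/n loop.
have [s1 [s2 [defs sub]]] := split_index (all_s (bar G y)).
have [y_s1 _] := sub _ lt_y; case: s1 => [//|z s1] in defs y_s1 {sub}.
move: defs => [<- {z} defs] in y_s1.
rewrite inE (negPf y3) /= in y_s1; case/splitPr: y_s1 defs => B C defs.
case/lastP: s2 => [|s2 z] in defs.
  by rewrite defs last_cat /= in lastv; rewrite lastv eqxx in by2.
move: lastv; rewrite defs last_cat /= last_rcons => zE; subst z.
have bp : bar G (last (bar G y) s2) = v3.
  apply: (@face_list_gap _ (v3 :: B ++ y :: C) _ _ _ [::]).
  by move: sl; rewrite defs -cats1; norm_cat; apply.
case/lastP: s2 => [|D z] in defs bp.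
  by move/(canRL (@barK G)): bp => /= bp; rewrite bp eqxx in byp.
rewrite last_rcons in bp; have {bp} zE := canRL (@barK G) bp; subst z.
have [|||c _ [_ _ _ b] o] := @surgery G (bar G v3) v3 y (bar G y) [:: n (n v)] B C D.
- rewrite defs -!cats1 in sl.
  by rotate_list (v3 :: B ++ y :: C ++ bar G y :: D) sl.
- exact: barK.
- by [].
by [].
Qed.

Hypothesis G1 : one_faced G.
Let w := bar G (n v).
Hypothesis wv : w \notin vertex_darts v.

(** The curve leaving [v] by [n v] goes straight through the vertex of [w] and comes back to [v]:
    the only strand it crosses there is that of [n w], which serves as [u]. *)
Lemma loop_opposite : bar G (n (n (n v))) = n (n w) -> reach_insert G.
Proof.
move=> opp; apply: (@handle_reach_insert G (n w) v) => //.
- by rewrite vertex_darts_sym vertex_darts_node.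
- by rewrite -/n -opp barK.
- by rewrite node4 barK.
Qed.

End Loop.

Lemma vertex_darts_neq (G : collection) (v w d e : G) : w \notin vertex_darts v ->
  d \in vertex_darts v -> e \in vertex_darts w -> (e == d) = false.
Proof.
move=> wv dv ew; apply: contraNF wv => /eqP ed; rewrite -ed vertex_darts_sym in dv.
by rewrite vertex_darts_sym; apply: vertex_darts_trans dv ew.
Qed.

(** The curve turns aside at the vertex of [w] instead of going straight. One surgery pairs
    [n (n (n v))] with [n (n w)], opposite to [w], and [loop_opposite] applies. *)
Lemma loop_adjacent (G : collection) (v : G) : one_faced G ->
  bar G v = node G (node G v) -> bar G (node G v) \notin vertex_darts v ->
  bar G (node G (node G (node G v))) = node G (bar G (node G v)) -> reach_insert G.
Proof.
pose n := node G; rewrite -!/n => G1 loop; set w := bar G (n v) => wv adj.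
have [s sl] := face_list_exists (n (n (n v))) G1.
pose v3 := n (n (n v)); pose t d := index d (v3 :: s).
have wvn d e := @vertex_darts_neq G v w d e wv.
have [v0v v1v v2v v3v] : [/\ v \in vertex_darts v, n v \in vertex_darts v,
    n (n v) \in vertex_darts v & v3 \in vertex_darts v].
  by rewrite !inE !eqxx ?orbT.
have [w0w w1w w2w] : [/\ w \in vertex_darts w, n w \in vertex_darts w
    & n (n w) \in vertex_darts w].
  by rewrite !inE !eqxx ?orbT.
have bv2 : bar G (n (n v)) = v by rewrite -loop barK.
have bw1 : bar G (n w) = v3 by rewrite -adj barK.
pose y := n (n w).
have [/negPf yw0 /negPf yw1] : y != w /\ y != n w.
  have := node_uniq w; rewrite /= !inE !negb_or -!andbA => /and5P[_ ? _ ? _].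
  by rewrite ![y == _]eq_sym.
have by_neq d : (bar G y == d) = (y == bar G d) by rewrite (can2_eq (@barK G) (@barK G)).
have out : {in [:: y; bar G y], forall d, d \notin [:: n (n v); v3; bar G v3]}.
  move=> d; rewrite !inE => /orP[] /eqP->; rewrite {1}/v3 adj.
    by rewrite yw1 !wvn.
  by rewrite !by_neq bv2 bw1 adj yw1 !wvn.
(* The word ends with [bar G y], [n w], [n (n v)]; as [y] is none of these, it comes earlier. *)
have lt_y : t y < t (bar G y).
  have t1 : t (n w) = (t (bar G y)).+1.
    by apply: (face_index_succ sl); rewrite ?barK // wvn.
  have t2 : t (n (n v)) = (t (n w)).+1.
    apply: (face_index_succ sl); rewrite ?bw1 //.
    by have := node_uniq (n (n v)); rewrite /= !inE !negb_or => /andP[/andP[]].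
  have t3 : t (n (n v)) = size s.
    by apply: (face_index_last sl); rewrite bv2 [RHS]node4.
  have := face_index_le sl y; rewrite -/(t y).
  have neq d : (y == d) = false -> t y != t d.
    by move=> yd; apply: contraFneq yd => /(face_index_inj sl) ->.
  have := neq (bar G y); rewrite eq_sym (negPf (bar_neq y)) => /(_ erefl).
  move: (neq _ yw1) (neq (n (n v)) (wvn _ _ v2v w2w)) t1 t2 t3.
  by clear; rewrite /t; lia.
have [c b3 o] := loop_surgery loop sl out lt_y.
set K := cut_open _ y in c b3 o *.
have bK d : d \in vertex_darts v -> d != v3 -> y != bar G d -> bar K d = bar G d.
  move=> dv d3 yd; apply: o; rewrite /= adj !inE !negb_or -/n -/v3 d3.
  by rewrite ![d == _]eq_sym by_neq (negPf yd) !wvn.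
have v03 : v != v3 by have := node_uniq v; rewrite /= !inE !negb_or => /andP[/and3P[_ _]].
have v13 : n v != v3 by have := node_uniq (n v); rewrite /= !inE !negb_or => /andP[/and3P[_ ]].
have bKv1 : bar K (n v) = w by apply: bK; rewrite ?yw0.
apply: (reach_insert_conn c); apply: (@loop_opposite K v).
- by rewrite bK // loop wvn.
- exact/(conn_one_faced c).
- by rewrite [node K]/= bKv1.
- by rewrite [node K]/= bKv1.
Qed.

(** Otherwise [n v] would be paired with its opposite too, and the single face would meet no vertex
    but that of [v], leaving only four half-edges. *)
Lemma loop_outward (G : collection) (v : G) : one_faced G -> 4 < #|G| ->
  bar G v = node G (node G v) -> bar G (node G v) \notin vertex_darts v.
Proof.
pose n := node G; rewrite -!/n => G1 ltG loop.
have bv2 : bar G (n (n v)) = v by rewrite -loop barK.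
have nv : n v != v by have := node_uniq v; rewrite /= !inE !negb_or eq_sym => /andP[/andP[]].
apply/negP; rewrite !inE => /or4P[] /eqP bv1.
- have /node_inj e : n v = n (n v) by rewrite -loop -[X in bar G X]bv1 barK.
  by rewrite -e eqxx in nv.
- by move: (bar_neq (n v)); rewrite bv1 eqxx.
- by rewrite -loop in bv1; rewrite (bar_inj bv1) eqxx in nv.
have bv3 : bar G (n (n (n v))) = n v by rewrite -bv1 barK.
have all_v : forall d, d \in vertex_darts v.
  apply: (@one_faced_ind G v (fun d => d \in vertex_darts v) G1) => [d|]; last exact: mem_head.
  rewrite -[face G d \in _]vertex_darts_node node_face !inE => /or4P[] /eqP->;
    by rewrite -?/n ?loop ?bv1 ?bv2 ?bv3 eqxx ?orbT.
have : #|G| <= size (vertex_darts v).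
  by rewrite (leq_trans _ (card_size _)) //; apply/subset_leq_card/subsetP=> d _; apply: all_v.
by rewrite leqNgt ltG.
Qed.

(** A first surgery, if necessary, brings the edge of [n (n (n v))] to the vertex reached from
    [n v]; a second one may be needed to make the two arrivals opposite. *)
Lemma loop_reach_insert (G : collection) (v : G) : one_faced G -> 4 < #|G| ->
  bar G v = node G (node G v) -> reach_insert G.
Proof.
pose n := node G; rewrite -!/n => G1 ltG loop.
have := loop_outward G1 ltG loop; rewrite -/n; set w := bar G (n v) => wv.
have bv2 : bar G (n (n v)) = v by rewrite -loop barK.
pose v3 := n (n (n v)).
have attached (H : collection) (x : H) : one_faced H -> bar H x = node H (node H x) ->
   bar H (node H x) \notin vertex_darts x ->
   bar H (node H (node H (node H x))) \in vertex_darts (bar H (node H x)) -> reach_insert H.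
  move=> H1 loopx out; rewrite inE => /orP[/eqP/bar_inj/node_inj e|].
    by have := node_uniq x; rewrite /= !inE e eqxx orbT.
  rewrite !inE => /or3P[/eqP|/eqP|/eqP adj].
  - exact: loop_adjacent.
  - exact: loop_opposite.
  (* The mirror case: read from the other end of the loop, the two outgoing half-edges exchange
     roles, and the adjacency is again a single quarter turn. *)
  apply: (@loop_adjacent H (node H (node H x))) => //.
  - by rewrite node4 -loopx barK.
  - rewrite adj vertex_darts_sym !vertex_darts_node.
    by rewrite vertex_darts_sym !vertex_darts_node.
  - by rewrite node4 adj node4.
have [pw|pw] := boolP (bar G v3 \in vertex_darts w); first exact: attached pw.
have [s sl] := face_list_exists v3 G1; pose t d := index d (v3 :: s).
have wvn d e := @vertex_darts_neq G v w d e wv.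
have [v0v v1v v2v v3v] : [/\ v \in vertex_darts v, n v \in vertex_darts v,
    n (n v) \in vertex_darts v & v3 \in vertex_darts v].
  by rewrite !inE !eqxx ?orbT.
have [w0w w1w w2w w3w] : [/\ w \in vertex_darts w, n w \in vertex_darts w,
    n (n w) \in vertex_darts w & n (n (n w)) \in vertex_darts w].
  by rewrite !inE !eqxx ?orbT.
have by_neq d e : (bar G d == e) = (d == bar G e) by rewrite (can2_eq (@barK G) (@barK G)).
(* Otherwise the positions of w0, w1, w2, w3 increase, and these four sides
   would lie within the four consecutive sides w0, v0, v1, w3. *)
have [y yw lt_y] : exists2 y, y \in [:: n w; n (n w); n (n (n w))] & t y < t (bar G y).
  have [a1|a1] := ltnP (t (n w)) (t (bar G (n w))); first by exists (n w); rewrite // !inE eqxx.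
  have [a2|a2] := ltnP (t (n (n w))) (t (bar G (n (n w)))).
    by exists (n (n w)); rewrite // !inE eqxx orbT.
  have [a3|a3] := ltnP (t (n (n (n w)))) (t (bar G (n (n (n w))))).
    by exists (n (n (n w))); rewrite // !inE eqxx !orbT.
  have neq d : t d != t (bar G d).
    by apply: contraNneq (bar_neq d) => /(face_index_inj sl) <-.
  have succ d e : bar G d = n e -> e != v3 -> t e = (t d).+1 by apply: face_index_succ.
  have c1 : t w = (t (bar G (n w))).+1 by apply: succ; rewrite ?barK // wvn.
  have c2 : t (n w) = (t (bar G (n (n w)))).+1 by apply: succ; rewrite ?barK // wvn.
  have c3 : t (n (n w)) = (t (bar G (n (n (n w))))).+1.
    by apply: succ; rewrite ?barK // wvn.
  have d1 : t v = (t w).+1.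
    apply: succ; rewrite ?barK //.
    by have := node_uniq v; rewrite /= !inE !negb_or => /andP[/and3P[]].
  have d2 : t (n v) = (t v).+1.
    by apply: succ => //; have := node_uniq (n v); rewrite /= !inE !negb_or => /andP[/and3P[]].
  have d3 : t (n (n (n w))) = (t (n v)).+1.
    by apply: succ; rewrite ?node4 // wvn.
  have ne : t (n w) != t v.
    by apply: contraFneq (wvn v (n w) v0v w1w) => /(face_index_inj sl) ->.
  have nneq d : t d != t (n d).
    apply/eqP=> /(face_index_inj sl) e.
    by have := node_uniq d; rewrite /= !inE -/n -e eqxx.
  move: (neq (n w)) (neq (n (n w))) (neq (n (n (n w)))) (nneq w) (nneq (n w)).
  by move: (nneq (n (n w))) a1 a2 a3 c1 c2 c3 d1 d2 d3 ne; clear; lia.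
have ywd : y \in vertex_darts w by rewrite inE yw orbT.
have yw0 : y != w.
  by apply: contraTneq yw => ->; have := node_uniq w; rewrite cons_uniq => /andP[].
have yv d : d \in vertex_darts v -> (y == d) = false by move=> dv; apply: wvn.
have yp : (y == bar G v3) = false by apply: contraNF pw => /eqP <-.
have [|//|c b3 o] := @loop_surgery G v loop s y sl.
  move=> d; rewrite !inE => /orP[] /eqP->; rewrite ?by_neq ?barK -/n -/v3 ?bv2.
    by rewrite (yv _ v2v) (yv _ v3v) yp.
  by rewrite (yv _ v0v) (yv _ v3v) yp.
set K := cut_open _ y in c b3 o *.
have v03 : v != v3 by have := node_uniq v; rewrite /= !inE !negb_or => /andP[/and3P[_ _]].
have v13 : n v != v3 by have := node_uniq (n v); rewrite /= !inE !negb_or => /andP[/and3P[_ ]].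
have v23 : n (n v) != v3 by have := node_uniq (n (n v)); rewrite /= !inE !negb_or => /andP[/andP[]].
have bKv1 : bar K (n v) = w.
  apply: o; rewrite !inE !negb_or; apply/and4P; split=> //.
  - by rewrite -by_neq -/w wvn.
  - by rewrite eq_sym yv.
  - by rewrite eq_sym by_neq.
have bKv0 : bar K v = n (n v).
  rewrite -loop; apply: o; rewrite !inE !negb_or; apply/and4P; split=> //.
  - by rewrite -by_neq loop.
  - by rewrite eq_sym yv.
  - by rewrite eq_sym by_neq loop yv.
apply: (reach_insert_conn c); apply: (@attached K v).
- exact/(conn_one_faced c).
- by rewrite bKv0.
- by rewrite [node K]/= bKv1.
- by rewrite [node K]/= bKv1 b3.
Qed.

Lemma one_faced_reach_insert (G : collection) :
  one_faced G -> 4 < #|G| -> reach_insert G.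
Proof.
move=> G1 ltG; have [v [X [Y [Z [W vG]]]]] := cyclic_vertex_exists G1.
have [K GK [w loop]] := cyclic_vertex_reach_loop vG.
apply: (reach_insert_conn GK); apply: loop_reach_insert loop.
  exact/(conn_one_faced GK).
by rewrite -(conn_card GK).
Qed.

Lemma card_insert (G : collection) (a : G) : #|insert a| = #|G| + 8.
Proof. by rewrite card_sum !card_prod card_bool. Qed.

(** * Connectedness *)

Lemma one_vertex_darts (G : collection) (d e : G) : #|G| = 4 -> e \in vertex_darts d.
Proof.
move=> cG; have cd : #|vertex_darts d| = #|[in G]|.
  by rewrite (card_uniqP (node_uniq d)) -[RHS]/(#|G|) cG.
by rewrite (subset_cardP cd _) //; apply/subsetP.
Qed.

(** If a half-edge were paired with one of its neighbours around the vertex, one side of that edge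
    would be a face by itself. *)
Lemma one_faced4_bar (G : collection) (d : G) :
  one_faced G -> #|G| = 4 -> bar G d = node G (node G d).
Proof.
move=> G1 cG.
have all_d e f := one_vertex_darts e f cG.
have nfix e : bar G e != node G e.
  apply/eqP=> /face_eq fe.
  have /eqP ne : pred1 e (node G e).
    apply: (@one_faced_ind G e (pred1 e) G1) => [d' /eqP->|]; last exact: eqxx.
    by rewrite fe; apply: eqxx.
  by have := node_uniq e; rewrite /= ne inE eqxx.
have := all_d d (bar G d); rewrite !inE => /or4P[] /eqP // bd.
- by have := bar_neq d; rewrite bd eqxx.
- by have := nfix d; rewrite bd eqxx.
by have := nfix (bar G d); rewrite {2}bd node4 barK eqxx.
Qed.

Lemma one_faced4_iso (G H : collection) :
  one_faced G -> one_faced H -> #|G| = 4 -> #|H| = 4 -> iso G H.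
Proof.
move=> G1 H1 cG cH; have [x _] := one_faced_inhabited G1.
have [y _] := one_faced_inhabited H1.
have Ux := node_uniq x; have Uy := node_uniq y.
pose h (d : G) := nth y (vertex_darts y) (index d (vertex_darts x)).
have all_x f := one_vertex_darts x f cG.
have lt4 d : index d (vertex_darts x) < 4 by rewrite index_mem.
have hn d : h (node G d) = node H (h d).
  have hi i : i < 4 -> h (nth x (vertex_darts x) i) = nth y (vertex_darts y) i.
    by move=> i4; rewrite /h index_uniq.
  have [h0 h1 h2 h3] := And4 (hi 0 isT) (hi 1 isT) (hi 2 isT) (hi 3 isT).
  rewrite /= in h0 h1 h2 h3; have := all_x d.
  by rewrite !inE => /or4P[] /eqP->; rewrite ?node4 ?h0 ?h1 ?h2 ?h3 ?node4.
exists h; split=> //.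
- apply: inj_card_bij; last by rewrite cG cH.
  move=> d e /eqP; rewrite nth_uniq // => /eqP de.
  by rewrite -(nth_index x (all_x d)) de nth_index.
- by move=> d; rewrite !one_faced4_bar // !hn.
Qed.

(** The edges carrying the handle are existential because a surgery may transport the handle to
    another edge; at a composition, [insert_move] reconciles the two choices on the middle
    collection. *)
Lemma conn_insert (G H : collection) : conn G H -> one_faced G ->
  exists (a : G) (c : H), conn (insert a) (insert c).
Proof.
elim=> {G H} [G H [h [bh hb hn]]|G x y G1 xy K1 _|G H GH IH H1|G H K GH IH1 HK IH2 G1].
- move=> G1; have [a _] := one_faced_inhabited G1; exists a, (h a).
  by apply: conn_iso; apply: insert_iso.
- by exists x, (tperm x y x); apply: insert_cut.
- have [|a [c ac]] := IH; first exact/(conn_one_faced GH).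
  by exists c, a; apply: conn_sym.
have H1 : one_faced H by apply/(conn_one_faced GH).
have [a [c ac]] := IH1 G1; have [d [e de]] := IH2 H1.
by exists a, e; apply: conn_trans ac (conn_trans (insert_move c d H1) de).
Qed.

Lemma one_faced_conn g (G H : collection) : one_faced G -> one_faced H ->
  #|G| + 4 = 8 * g -> #|H| + 4 = 8 * g -> conn G H.
Proof.
(* Genus 0 is excluded by the count of half-edges; the induction really starts at genus 1, where the
   only one-faced collection has one vertex. *)
elim: g G H => [|g IHg] G H G1 H1 cG cH; first by lia.
case: (posnP g) => [g0|g_gt0].
  by subst g; apply/conn_iso/one_faced4_iso => //; lia.
have [|G' [a Ga]] := one_faced_reach_insert G1; first by lia.
have [|H' [b Hb]] := one_faced_reach_insert H1; first by lia.
have cG' := conn_card Ga; rewrite card_insert in cG'.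
have cH' := conn_card Hb; rewrite card_insert in cH'.
have G'1 : one_faced G' by apply/(insert_one_faced a)/(conn_one_faced Ga).
have H'1 : one_faced H' by apply/(insert_one_faced b)/(conn_one_faced Hb).
apply: conn_trans Ga (conn_trans _ (conn_sym Hb)).
have [c [c' cc']] := conn_insert (IHg _ _ G'1 H'1 ltac:(lia) ltac:(lia)) G'1.
apply: conn_trans (conn_trans (insert_move a c G'1) cc') (insert_move _ _ H'1).
Qed.

Lemma one_faced_on_card g G : one_faced_on g G <-> one_faced G /\ #|G| + 4 = 8 * g.
Proof. by split=> -[G1 gG]; split=> //; apply/(has_genusE _ G1). Qed.

(** * One-faced collections of every positive genus *)

Lemma rot4_inj : injective rot4.
Proof. by move=> [[] []] [[] []]. Qed.

Definition torus_bar (p : bool * bool) : bool * bool := (~~ p.1, ~~ p.2).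

Lemma torus_barK : involutive torus_bar.
Proof. by move=> [[] []]. Qed.

(* Two simple closed curves crossing once. *)
Definition torus : collection.
Proof.
apply: (@Collection (bool * bool)%type 
  (perm rot4_inj) (perm (inv_inj torus_barK))).
- by move=> d; apply: card_porbit4; rewrite !permE; case: d => [[] []].
- by move=> d; rewrite !permE torus_barK.
- by move=> d; rewrite permE; case: d => [[] []].
Defined.

Lemma torus_one_faced : one_faced torus.
Proof.
pose x : torus := (false, false).
apply: (@face_list_one_faced torus x (behead (vertex_darts x))).
split=> //.
- exact: node_uniq.
- by rewrite /= /face_step /= !permE.
by move=> d; apply: one_vertex_darts; rewrite card_prod card_bool.
Qed.

Lemma one_faced_on_exists g : 0 < g -> exists G, one_faced_on g G.
Proof.
elim: g => // -[_ _|g IHg _].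
  exists torus; apply/one_faced_on_card; split; first exact: torus_one_faced.
  by rewrite card_prod card_bool.
have [//|G /one_faced_on_card[G1 cG]] := IHg; have [a _] := one_faced_inhabited G1.
exists (insert a); apply/one_faced_on_card; rewrite card_insert; split; last by lia.
exact: (insert_one_faced a).1 G1.
Qed.

(** * From equivalent collections to paths in the surgery graph *)

Lemma homeomorphic_refl G : homeomorphic G G.
Proof. by exists id; split=> //; [exists id|left]. Qed.

Lemma iso_homeomorphic G H : iso G H -> homeomorphic G H.
Proof. by case=> h [bh hb hn]; exists h; split=> //; left. Qed.

Lemma morph_permV (T U : finType) (h : T -> U) (s : {perm T}) (t : {perm U}) :
  (forall d, h (s d) = t (h d)) -> forall d, h ((s^-1)%g d) = (t^-1)%g (h d).
Proof. by move=> hs d; apply: (@perm_inj _ t); rewrite permKV -hs permKV. Qed.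

Lemma homeomorphic_sym G H : homeomorphic G H -> homeomorphic H G.
Proof.
case=> h [[k hK kK] hb hn]; exists k; split; first by exists h.
  by move=> d; apply: (can_inj hK); rewrite hb !kK.
case: hn => hn; [left|right] => d; apply: (can_inj hK); rewrite ?hn ?kK //.
by rewrite (morph_permV hn) invgK kK.
Qed.

Lemma homeomorphic_trans G H K : homeomorphic G H -> homeomorphic H K -> homeomorphic G K.
Proof.
case=> h [bh hb hn] [k [bk kb kn]]; exists (k \o h); split.
- exact: bij_comp.
- by move=> d; rewrite /= hb kb.
case: hn kn => hn [] kn; [left|right|right|left] => d; rewrite /= hn.
- by rewrite kn.
- by rewrite kn.
- by rewrite (morph_permV kn).
by rewrite (morph_permV kn) invgK.
Qed.

Lemma homeomorphic_class G H : homeomorphic G H -> homeomorphic G = homeomorphic H.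
Proof.
move=> GH; apply: functional_extensionality => K; apply: propositional_extensionality.
by split; apply: homeomorphic_trans => //; apply: homeomorphic_sym.
Qed.

Lemma Kedge_sym g (u v : Kvertex g) : Kedge u v -> Kedge v u.
Proof. by case=> uv [step|step]; split; [exact: not_eq_sym|right|exact: not_eq_sym|left]. Qed.

Lemma Kpath_sym g (u v : Kvertex g) :
  clos_refl_trans _ (@Kedge g) u v -> clos_refl_trans _ (@Kedge g) v u.
Proof.
elim=> {u v} [u v /Kedge_sym ?|u|u v w _ vu _ wv]; first exact: rt_step.
  exact: rt_refl.
exact: rt_trans wv vu.
Qed.

Lemma conn_Kpath g G H (u v : Kvertex g) : conn G H -> one_faced_on g G ->
  sval u = homeomorphic G -> sval v = homeomorphic H ->
  clos_refl_trans _ (@Kedge g) u v.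
Proof.
have uniq_class (u' v' : Kvertex g) : sval u' = sval v' -> u' = v'.
  by case: u' v' => [C cC] [D cD] /= CD; apply: subset_eq_compat.
move=> GH; elim: GH u v => {G H} [G H GH|G x y G1 xy K1|G H GH IH|G H K GH IH1 HK IH2] u v Gg uG vH.
- rewrite (uniq_class u v); first exact: rt_refl.
  by rewrite uG vH; apply/homeomorphic_class/iso_homeomorphic.
(* A surgery may produce a homeomorphic collection; since [Kedge] has no loops, the path is then
   empty. *)
- have [->|uv] := classic (u = v); first exact: rt_refl.
  apply: rt_step; split=> //; left; exists G, x, y; rewrite uG vH.
  by split=> //; apply: homeomorphic_refl.
- by apply/Kpath_sym/IH => //; apply/(conn_one_faced_on g GH).
have Hg : one_faced_on g H by apply/(conn_one_faced_on g GH).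
pose w : Kvertex g := exist _ (homeomorphic H) (ex_intro2 _ _ H Hg erefl).
by apply: (rt_trans _ _ _ w); [apply: IH1|apply: IH2].
Qed.

Theorem theorem1 (g : nat) : 1 <= g -> connected_graph (@Kedge g).
Proof.
move=> g1; split.
  have [G gG] := one_faced_on_exists g1.
  by constructor; exists (homeomorphic G); exists G.
move=> u v; have [G gG uG] := svalP u; have [H gH vH] := svalP v.
have [[G1 cG] [H1 cH]] := ((one_faced_on_card g G).1 gG, (one_faced_on_card g H).1 gH).
by apply: (conn_Kpath _ gG uG vH); apply: (@one_faced_conn g).
Qed.
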